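(* Let $\psi_1,\psi_2\in\mathcal{P}$ satisfy $\max_{|z|=r}\Re\psi_i(z)=\psi_i(r)$ for $0<r<1$, $i=1,2$, and let $\beta>1$. Let $g\in\mathcal{S}^*(\psi_1)$ and $h\in\mathcal{S}^*(\psi_2)$. Then the function $$F(z)=\frac{g(z)h(z)}{z}$$ belongs to $\mathcal{M}(\beta)$ in the disk $|z|<r_\beta=\min\{1,r_0(\beta)\}$, where $r_0(\beta)$ is the least positive root of the equation $$\psi_1(r)+\psi_2(r)-1-\beta=0.$$ The radius $r_\beta$ is sharp.
   Context: $\mathbb{D}=\{z:|z|<1\}$. $\mathcal{A}$ is the class of analytic functions $f(z)=z+\sum_{k\ge2}a_kz^k$ in $\mathbb{D}$. $\mathcal{P}$ is the class of normalized Carathéodory functions: $p$ analytic in $\mathbb{D}$, $p(0)=1$, $\Re p(z)>0$. $\prec$ denotes subordination. $\mathcal{S}^*(\psi)=\{f\in\mathcal{A}:zf'(z)/f(z)\prec\psi(z)\}$. $\mathcal{M}(\beta)=\{f\in\mathcal{A}:\Re(zf'(z)/f(z))<\beta\}$, $\beta>1$; ''$F$ belongs to $\mathcal{M}(\beta)$ in $|z|<\rho$'' means $\Re(zF'(z)/F(z))<\beta$ for $|z|<\rho$. If the equation has no root in $(0,1)$, then $r_\beta=1$. ''Sharp'' means that the radius cannot be replaced by a larger one valid for all such $g,h$. *)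

(* Defs.v *)
From Stdlib Require Import Reals.
From Coquelicot Require Import Coquelicot.
Open Scope C_scope.

(* Functions on the unit disk are total maps C -> C of which only the values
   on |z| < 1 are ever used. *)
Definition in_disk (z : C) : Prop := (Cmod z < 1)%R.

Definition analytic_on_disk (f : C -> C) : Prop :=
  forall z : C, in_disk z -> @ex_derive C_AbsRing C_NormedModule f z.

Definition class_A (f : C -> C) : Prop :=
  analytic_on_disk f /\
  exists a : nat -> C,
    a 0%nat = 0 /\ a 1%nat = 1 /\
    forall z : C, in_disk z -> @is_pseries C_AbsRing C_NormedModule a z (f z).

Definition caratheodory (p : C -> C) : Prop :=
  analytic_on_disk p /\ p 0 = 1 /\
  forall z : C, in_disk z -> (0 < Re (p z))%R.

Definition schwarz_function (w : C -> C) : Prop :=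
  analytic_on_disk w /\ w 0 = 0 /\ forall z : C, in_disk z -> in_disk (w z).

Definition subordinate (q psi : C -> C) : Prop :=
  exists w : C -> C, schwarz_function w /\
    forall z : C, in_disk z -> q z = psi (w z).

(* z f'(z) / f(z), with the removable singularity at 0 filled in: for f in
   class_A its value there is 1. *)
Definition starlike_quotient (f : C -> C) (z : C) : C :=
  if Req_EM_T (Cmod z) 0 then 1 else z * C_derive f z / f z.

(* Division by 0 is total in Coquelicot, so the non-vanishing that makes
   z f'(z) / f(z) finite away from 0 is required explicitly. *)
Definition nonvanishing_in (rho : R) (f : C -> C) : Prop :=
  forall z : C, (Cmod z < rho)%R -> z <> 0 -> f z <> 0.

Definition starlike_class (psi f : C -> C) : Prop :=
  class_A f /\ nonvanishing_in 1 f /\ subordinate (starlike_quotient f) psi.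

Definition class_M_in_disk (beta rho : R) (f : C -> C) : Prop :=
  class_A f /\ nonvanishing_in rho f /\
  forall z : C, (Cmod z < rho)%R -> (Re (starlike_quotient f z) < beta)%R.

Definition is_max_Re_on_circle (psi : C -> C) (r m : R) : Prop :=
  (exists z : C, Cmod z = r /\ Re (psi z) = m) /\
  forall z : C, Cmod z = r -> (Re (psi z) <= m)%R.

(* The equality with psi r holds in C, so psi r is in particular real. *)
Definition max_Re_on_positive_axis (psi : C -> C) : Prop :=
  forall r : R, (0 < r < 1)%R ->
    exists m : R, is_max_Re_on_circle psi r m /\ RtoC m = psi (RtoC r).

(* Positive roots are sought in (0,1), where psi1 and psi2 are defined. *)
Definition is_root (psi1 psi2 : C -> C) (beta r : R) : Prop :=
  (0 < r < 1)%R /\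
  psi1 (RtoC r) + psi2 (RtoC r) - 1 - RtoC beta = 0.

Definition is_least_root (psi1 psi2 : C -> C) (beta r0 : R) : Prop :=
  is_root psi1 psi2 beta r0 /\
  forall r : R, is_root psi1 psi2 beta r -> (r0 <= r)%R.

Definition is_radius (psi1 psi2 : C -> C) (beta rbeta : R) : Prop :=
  (exists r0 : R, is_least_root psi1 psi2 beta r0 /\ rbeta = Rmin 1 r0) \/
  ((forall r : R, ~ is_root psi1 psi2 beta r) /\ rbeta = 1%R).

(* Main.v *)
Require Import Defs.
From Stdlib Require Import Reals Lra Lia Psatz Classical.
From Coquelicot Require Import Coquelicot.
Open Scope C_scope.

(** Logarithmic differentiation of F = g h / z gives
    z F' / F = z g' / g + z h' / h - 1. If the two quotients on the right are
    psi1 and psi2 composed with Schwarz functions w1 and w2, then |w_i z| <= |z| by Schwarz's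
    lemma, and the maximum principle for Re psi_i together with the hypothesis
    on circles gives Re (z F' / F) <= psi1 r + psi2 r - 1 for r = |z|
    ([schwarz_lemma], [Re_le_on_axis]). The real function
    phi r = psi1 r + psi2 r - 1 - beta is continuous on [0, 1) and equals
    1 - beta < 0 at 0, so it is negative up to its first zero r0, which exists
    as soon as some zero does ([least_zero_exists],
    [negative_before_first_zero]).

    For sharpness one solves z g' / g = psi1 and z h' / h = psi2 in the disk,
    by g = z exp (primitive of (psi1 - 1) / z) and likewise for h
    ([starlike_function_exists]). The value of z F' / F at r0 is then exactly
    beta, so no larger radius is possible.

    These arguments rest on Cauchy's theory for functions that are only assumed
    complex differentiable at each point of the disk. Goursat's bisection is
    carried out on the parameter rectangle of a homotopy
    ([boundary_integral_zero]), and then applied to deformations along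
    straight lines ([line_homotopy]). Contracting a circle to an
    interior point yields Cauchy's formula ([cauchy_formula]), from which come
    the maximum principle (through powers of f), the removability of the
    singularity of f(z) / z when f 0 = 0, and the Taylor expansion. The latter
    reduces the class A to the conditions f 0 = 0 and f' 0 = 1 on analytic
    functions ([class_A_iff]), so power series are not manipulated further. *)

(** * Complex derivatives *)

Definition is_cderive (f : C -> C) (z l : C) : Prop :=
  @is_derive C_AbsRing C_NormedModule f z l.

Definition is_curve_derive (gam : R -> C) (t : R) (d : C) : Prop :=
  @is_derive R_AbsRing C_R_NormedModule gam t d.

(** The epsilon-delta form is used for all hand-made derivatives; it also frees
    the later estimates from the two uniform structures carried by C. *)
Lemma is_cderive_eps (f : C -> C) (z l : C) :
  is_cderive f z l <->
  forall eps : R, (0 < eps)%R -> exists delta : R, (0 < delta)%R /\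
    forall y : C, (Cmod (y - z) < delta)%R ->
      (Cmod (f y - f z - (y - z) * l) <= eps * Cmod (y - z))%R.
Proof.
  split.
  - intros [_ H] eps Heps.
    destruct (H z (fun P HP => HP) (mkposreal eps Heps)) as [d Hd].
    exists d. split; [apply cond_pos|]. intros y Hy. exact (Hd y Hy).
  - intros H. split.
    + apply (is_linear_scal_l (K:=C_AbsRing) (V:=C_NormedModule)).
    + intros x Hx.
      assert (E : z = x).
      { apply (is_filter_lim_locally_unique (K:=C_AbsRing)
                 (V:=AbsRing_NormedModule C_AbsRing)). exact Hx. }
      subst x. intros eps. destruct (H eps (cond_pos eps)) as [d [Hd H']].
      exists (mkposreal d Hd). intros y Hy. exact (H' y Hy).
Qed.

(** The generic product and chain rules see C as a module over itself as a ring.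
    The two modules have the same norm and operations; only their topologies
    are presented differently. *)
Lemma is_cderive_AbsRing (f : C -> C) (z l : C) :
  is_cderive f z l <->
  @is_derive C_AbsRing (AbsRing_NormedModule C_AbsRing) f z l.
Proof.
  split; intros [[H1 H2 H3] H4];
    (split; [split; [exact H1|exact H2|exact H3]|exact H4]).
Qed.

Lemma is_cderive_const (c z : C) : is_cderive (fun _ => c) z 0.
Proof. exact (is_derive_const (K:=C_AbsRing) (V:=C_NormedModule) c z). Qed.

Lemma is_cderive_id (z : C) : is_cderive (fun y => y) z (RtoC 1).
Proof. apply is_cderive_AbsRing. apply (is_derive_id (K:=C_AbsRing)). Qed.

Lemma is_cderive_plus (f g : C -> C) (z l m : C) :
  is_cderive f z l -> is_cderive g z m ->
  is_cderive (fun y => f y + g y) z (l + m).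
Proof. apply (is_derive_plus (K:=C_AbsRing) (V:=C_NormedModule)). Qed.

Lemma is_cderive_mult (f g : C -> C) (z l m : C) :
  is_cderive f z l -> is_cderive g z m ->
  is_cderive (fun y => f y * g y) z (l * g z + f z * m).
Proof.
  intros H1 H2. apply is_cderive_AbsRing.
  apply is_cderive_AbsRing in H1. apply is_cderive_AbsRing in H2.
  apply (is_derive_mult (K:=C_AbsRing) f g z l m H1 H2).
  exact Cmult_comm.
Qed.

Lemma is_cderive_comp (f g : C -> C) (z l m : C) :
  is_cderive f (g z) l -> is_cderive g z m ->
  is_cderive (fun y => f (g y)) z (m * l).
Proof.
  intros H1 H2. apply is_cderive_AbsRing in H2.
  exact (is_derive_comp (K:=C_AbsRing) (V:=C_NormedModule) f g z l m H1 H2).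
Qed.

Lemma is_cderive_ext_loc (f g : C -> C) (z l : C) (d : R) :
  (0 < d)%R -> (forall y, (Cmod (y - z) < d)%R -> f y = g y) ->
  is_cderive f z l -> is_cderive g z l.
Proof.
  intros Hd E. apply (is_derive_ext_loc (K:=C_AbsRing) (V:=C_NormedModule)).
  exists (mkposreal d Hd). intros y Hy. exact (E y Hy).
Qed.

Lemma is_cderive_eq (f : C -> C) (z l m : C) :
  is_cderive f z l -> l = m -> is_cderive f z m.
Proof. intros H E; rewrite <- E; exact H. Qed.

Lemma is_cderive_unique (f : C -> C) (z l m : C) :
  is_cderive f z l -> is_cderive f z m -> l = m.
Proof.
  intros H1 H2. apply is_C_derive_unique in H1. apply is_C_derive_unique in H2.
  congruence.
Qed.

Lemma Cmod_minus_ge (a b : C) : (Cmod a - Cmod b <= Cmod (a - b))%R.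
Proof.
  generalize (Cmod_triangle (a - b) b).
  replace (a - b + b) with a by ring. lra.
Qed.

Lemma Cmod_minus_sym (a b : C) : Cmod (a - b) = Cmod (b - a).
Proof. rewrite <- Cmod_opp. f_equal. ring. Qed.

Lemma is_cderive_inv (z : C) : z <> 0 -> is_cderive (fun y => / y) z (- / (z * z)).
Proof.
  intros Hz. apply is_cderive_eps. intros eps Heps.
  assert (Hm : (0 < Cmod z)%R) by (apply Cmod_gt_0; exact Hz).
  set (m := Cmod z) in *.
  set (d := Rmin (m / 2) (eps * (m * m * m) / 2)).
  exists d. split.
  { apply Rmin_pos; [lra|]. apply Rdiv_lt_0_compat; [|lra].
    repeat apply Rmult_lt_0_compat; assumption. }
  intros y Hy.
  assert (Hd1 : (d <= m / 2)%R) by apply Rmin_l.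
  assert (Hd2 : (d <= eps * (m * m * m) / 2)%R) by apply Rmin_r.
  assert (Hym : (m / 2 < Cmod y)%R).
  { generalize (Cmod_minus_ge z y). rewrite Cmod_minus_sym. fold m. lra. }
  assert (Hy0 : y <> 0) by (apply Cmod_gt_0; lra).
  replace (/ y - / z - (y - z) * - / (z * z))
    with ((y - z) * (y - z) * / (z * z * y)) by (field; auto).
  rewrite !Cmod_mult, Cmod_inv, !Cmod_mult
    by (repeat apply Cmult_neq_0; assumption).
  fold m. rewrite (Rmult_assoc (Cmod (y - z))), Rmult_comm.
  apply Rmult_le_compat_r; [apply Cmod_ge_0|].
  apply (Rmult_le_reg_r (m * m * Cmod y)).
  { repeat apply Rmult_lt_0_compat; lra. }
  rewrite Rmult_assoc, Rinv_l, Rmult_1_r.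
  2: { apply Rgt_not_eq. repeat apply Rmult_lt_0_compat; lra. }
  apply Rle_trans with (eps * (m * m * (m / 2)))%R; [lra|].
  apply Rmult_le_compat_l; [lra|]. apply Rmult_le_compat_l; [|lra]. nra.
Qed.

(** Complex differentiability implies continuity for the product topology on
    pairs of reals, which is the one that the integral of curves uses. *)
Lemma is_cderive_continuous (f : C -> C) (z l : C) :
  is_cderive f z l -> @continuous C_UniformSpace C_UniformSpace f z.
Proof.
  intros H P HP.
  apply (@ex_derive_continuous C_AbsRing C_NormedModule f z (ex_intro _ l H))
    in HP.
  apply locally_C. exact HP.
Qed.

Lemma continuous_Cmult (U : UniformSpace) (f g : U -> C) (x : U) :
  @continuous U C_UniformSpace f x -> @continuous U C_UniformSpace g x ->
  @continuous U C_UniformSpace (fun y => f y * g y) x.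
Proof.
  assert (T : forall h : U -> C, @continuous U C_UniformSpace h x <->
                @continuous U (AbsRing_UniformSpace C_AbsRing) h x).
  { intros h; split; intros H P HP; apply H; apply locally_C; exact HP. }
  intros Hf Hg. apply T. apply T in Hf. apply T in Hg.
  exact (continuous_mult (K:=C_AbsRing) f g x Hf Hg).
Qed.

Lemma norm_curve (z : C_R_NormedModule) : norm z = Cmod z.
Proof. symmetry. exact (Cmod_norm z). Qed.

(** A complex derivative is in particular a real-linear differential, so it
    composes with the velocity of a curve. *)
Lemma is_cderive_curve (f : C -> C) (gam : R -> C) (t : R) (l d : C) :
  is_cderive f (gam t) l -> is_curve_derive gam t d ->
  is_curve_derive (fun u => f (gam u)) t (d * l).
Proof.
  intros Hf Hg.
  assert (Hf' : @filterdiff R_AbsRing C_R_NormedModule C_R_NormedModule f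
                  (locally (gam t)) (fun h : C => h * l)).
  { split.
    - split.
      + intros x y. exact (Cmult_plus_distr_r x y l).
      + intros k x. change (scal k x * l = scal k (x * l)).
        rewrite !scal_R_Cmult. ring.
      + exists (Cmod l + 1)%R. split.
        * generalize (Cmod_ge_0 l). lra.
        * intros x.
          rewrite !norm_curve, Cmod_mult.
          generalize (Cmod_ge_0 x). nra.
    - intros x Hx.
      assert (E : gam t = x).
      { apply (is_filter_lim_locally_unique (K:=R_AbsRing)
                 (V:=C_R_NormedModule)). exact Hx. }
      subst x. intros eps.
      destruct Hf as [_ Hf].
      generalize (Hf (gam t) (fun P HP => HP) eps). intros H.
      apply (proj2 (locally_C _ _)) in H.
      revert H. apply filter_imp. intros y Hy.
      rewrite !norm_curve.
      exact Hy. }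
  generalize (filterdiff_comp' (K:=R_AbsRing) gam f t _ _ Hg Hf').
  intros H. unfold is_derive.
  eapply filterdiff_ext_lin; [exact H|]. intros y. cbn beta.
  change (scal y d * l = scal y (d * l)).
  rewrite !scal_R_Cmult. ring.
Qed.

(** * The complex exponential *)

Definition cexp (z : C) : C := (exp (Re z) * cos (Im z), exp (Re z) * sin (Im z))%R.

Lemma cexp_plus (a b : C) : cexp (a + b) = cexp a * cexp b.
Proof.
  destruct a as [a1 a2], b as [b1 b2]. unfold cexp, Cmult; simpl.
  rewrite exp_plus, cos_plus, sin_plus. f_equal; ring.
Qed.

Lemma cexp_0 : cexp 0 = 1.
Proof. unfold cexp; simpl. rewrite exp_0, cos_0, sin_0. unfold RtoC. f_equal; ring. Qed.

Lemma Cmod_cexp (z : C) : Cmod (cexp z) = exp (Re z).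
Proof.
  unfold Cmod, cexp; simpl.
  transitivity (sqrt (Rsqr (exp (Re z)))).
  - f_equal. unfold Rsqr.
    generalize (sin2_cos2 (Im z)); unfold Rsqr; intros H.
    replace (exp (Re z) * cos (Im z) * (exp (Re z) * cos (Im z) * 1) +
      exp (Re z) * sin (Im z) * (exp (Re z) * sin (Im z) * 1))%R with
      (exp (Re z) * exp (Re z) * (sin (Im z) * sin (Im z) + cos (Im z) * cos (Im z)))%R by ring.
    rewrite H. ring.
  - apply sqrt_Rsqr. left. apply exp_pos.
Qed.

Lemma cexp_neq_0 (z : C) : cexp z <> 0.
Proof. apply Cmod_gt_0. rewrite Cmod_cexp. apply exp_pos. Qed.

Lemma derivable_pt_lim_0_expansion (f : R -> R) (l : R) :
  derivable_pt_lim f 0 l -> forall eps, (0 < eps)%R -> exists d, (0 < d)%R /\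
   forall h, (Rabs h < d)%R -> (Rabs (f h - f 0 - h * l) <= eps * Rabs h)%R.
Proof.
  intros H eps Heps. destruct (H eps Heps) as [d Hd]. exists d.
  split; [apply cond_pos|]. intros h Hh.
  destruct (Req_dec h 0) as [->|Hh0].
  - replace (f 0 - f 0 - 0 * l)%R with 0%R by ring. rewrite Rabs_R0. lra.
  - generalize (Hd h Hh0 Hh). rewrite Rplus_0_l. intros H1.
    replace (f h - f 0 - h * l)%R with (((f h - f 0) / h - l) * h)%R by (field; auto).
    rewrite Rabs_mult. apply Rmult_le_compat_r; [apply Rabs_pos|lra].
Qed.

Lemma Cmod_le_Rabs (z : C) : (Cmod z <= Rabs (Re z) + Rabs (Im z))%R.
Proof.
  replace z with (RtoC (Re z) + Ci * RtoC (Im z)).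
  - eapply Rle_trans; [apply Cmod_triangle|].
    rewrite Cmod_mult, Cmod_Ci, !Cmod_R. simpl.
    unfold RtoC, Ci, Cmult, Cplus; simpl.
    replace (Re z + (0 * Im z - 1 * 0))%R with (Re z) by ring.
    replace (0 + (0 * 0 + 1 * Im z))%R with (Im z) by ring. lra.
  - destruct z; unfold RtoC, Ci, Cmult, Cplus; simpl; f_equal; ring.
Qed.

Lemma Rabs_Im_le_Cmod (z : C) : (Rabs (Im z) <= Cmod z)%R.
Proof.
  eapply Rle_trans; [|apply (Rmax_Cmod z)]. apply Rmax_r.
Qed.

(** With z = a + b i, write e^a cos b - 1 - a as (e^a - 1 - a) + e^a (cos b - 1)
    and e^a sin b - b as e^a (sin b - b) + (e^a - 1) b: the first-order
    expansions of exp, cos and sin at 0 bound every summand. *)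
Lemma is_cderive_cexp_0 : is_cderive cexp 0 1.
Proof.
  apply is_cderive_eps. intros eps Heps.
  set (e := Rmin (eps / 16) (1/2)).
  assert (He : (0 < e)%R) by (apply Rmin_pos; lra).
  assert (He1 : (e <= eps / 16)%R) by apply Rmin_l.
  assert (He2 : (e <= 1/2)%R) by apply Rmin_r.
  destruct (derivable_pt_lim_0_expansion _ _ derivable_pt_lim_exp_0 e He) as [d1 [Hd1 H1]].
  assert (Hc := derivable_pt_lim_cos 0). rewrite sin_0, Ropp_0 in Hc.
  destruct (derivable_pt_lim_0_expansion _ _ Hc e He) as [d2 [Hd2 H2]].
  assert (Hs := derivable_pt_lim_sin 0). rewrite cos_0 in Hs.
  destruct (derivable_pt_lim_0_expansion _ _ Hs e He) as [d3 [Hd3 H3]].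
  exists (Rmin e (Rmin d1 (Rmin d2 d3))). split.
  { clearbody e. repeat apply Rmin_pos; assumption. }
  intros y Hy. replace (y - 0) with y in * by ring.
  destruct (Rmin_Rgt_l _ _ _ Hy) as [Ha Hy1].
  destruct (Rmin_Rgt_l _ _ _ Hy1) as [Hb Hy2].
  destruct (Rmin_Rgt_l _ _ _ Hy2) as [Hc' Hd].
  assert (Hr := re_le_Cmod y). assert (Hi := Rabs_Im_le_Cmod y).
  rewrite cexp_0.
  assert (L1 := H1 (Re y) ltac:(lra)). rewrite exp_0 in L1.
  assert (L2 := H2 (Im y) ltac:(lra)). rewrite cos_0 in L2.
  assert (L3 := H3 (Im y) ltac:(lra)). rewrite sin_0 in L3.
  eapply Rle_trans; [apply Cmod_le_Rabs|].
  set (m := Cmod y) in *.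
  replace (Re (cexp y - 1 - y * 1)) with
    ((exp (Re y) - 1 - Re y * 1) + exp (Re y) * (cos (Im y) - 1 - Im y * 0))%R.
  2: { destruct y; unfold cexp; simpl; ring. }
  replace (Im (cexp y - 1 - y * 1)) with
    (exp (Re y) * (sin (Im y) - 0 - Im y * 1) +
     ((exp (Re y) - 1 - Re y * 1) + Re y) * Im y)%R.
  2: { destruct y; unfold cexp; simpl; ring. }
  assert (Hm0 : (0 <= m)%R) by apply Cmod_ge_0.
  set (u := (exp (Re y) - 1 - Re y * 1)%R) in *.
  set (v := (cos (Im y) - 1 - Im y * 0)%R) in *.
  set (w := (sin (Im y) - 0 - Im y * 1)%R) in *.
  assert (Hu : (Rabs u <= e * m)%R) by nra.
  assert (Hv : (Rabs v <= e * m)%R) by nra.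
  assert (Hw : (Rabs w <= e * m)%R) by nra.
  assert (Hx : (exp (Re y) <= 3)%R).
  { replace (exp (Re y)) with (u + 1 + Re y)%R by (unfold u; ring).
    generalize (Rle_abs u) (Rle_abs (Re y)). nra. }
  assert (Hx0 := exp_pos (Re y)).
  generalize (Rabs_triang u (exp (Re y) * v))
     (Rabs_triang (exp (Re y) * w) ((u + Re y) * Im y)) (Rabs_triang u (Re y)).
  rewrite !Rabs_mult, (Rabs_pos_eq (exp (Re y))) by lra.
  intros T1 T2 T3.
  assert ((exp (Re y) * Rabs v <= 3 * (e * m))%R).
  { apply Rmult_le_compat; try lra. apply Rabs_pos. }
  assert ((exp (Re y) * Rabs w <= 3 * (e * m))%R).
  { apply Rmult_le_compat; try lra. apply Rabs_pos. }
  assert ((Rabs (u + Re y) * Rabs (Im y) <= (2 * e) * m)%R).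
  { apply Rmult_le_compat; try apply Rabs_pos; try lra. nra. }
  nra.
Qed.

(** Differentiability at 0 is transported to z by cexp y = cexp z cexp (y - z). *)
Lemma is_cderive_cexp (z : C) : is_cderive cexp z (cexp z).
Proof.
  apply is_cderive_eps. intros eps Heps.
  assert (Hz : (0 < Cmod (cexp z))%R) by (rewrite Cmod_cexp; apply exp_pos).
  destruct (proj1 (is_cderive_eps _ _ _) is_cderive_cexp_0 (eps / Cmod (cexp z))%R)
    as [d [Hd H]].
  { apply Rdiv_lt_0_compat; assumption. }
  exists d. split; [exact Hd|]. intros y Hy.
  generalize (H (y - z)). replace (y - z - 0) with (y - z) by ring.
  intros H'. specialize (H' Hy). rewrite cexp_0 in H'.
  replace (cexp y) with (cexp z * cexp (y - z)) by (rewrite <- cexp_plus; f_equal; ring).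
  replace (cexp z * cexp (y - z) - cexp z - (y - z) * cexp z)
    with (cexp z * (cexp (y - z) - 1 - (y - z) * 1)) by ring.
  rewrite Cmod_mult.
  apply Rmult_le_compat_l with (r := Cmod (cexp z)) in H'; [|lra].
  eapply Rle_trans; [exact H'|]. right. field. lra.
Qed.

(** * Integrals of complex curves *)

Definition continuous_curve (gam : R -> C) (a b : R) : Prop :=
  forall t, (a <= t <= b)%R -> @continuous R_UniformSpace C_UniformSpace gam t.

Definition CInt (gam : R -> C) (a b : R) : C :=
  @RInt C_R_CompleteNormedModule gam a b.

Lemma ex_CInt (gam : R -> C) (a b : R) : (a <= b)%R ->
  continuous_curve gam a b -> @ex_RInt C_R_NormedModule gam a b.
Proof.
  intros Hab H. apply (ex_RInt_continuous (V:=C_R_CompleteNormedModule)).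
  intros t. rewrite Rmin_left, Rmax_right by exact Hab. apply H.
Qed.

Lemma is_CInt (gam : R -> C) (a b : R) : (a <= b)%R ->
  continuous_curve gam a b -> @is_RInt C_R_NormedModule gam a b (CInt gam a b).
Proof.
  intros Hab H. apply (RInt_correct (V:=C_R_CompleteNormedModule)).
  apply ex_CInt; assumption.
Qed.

Lemma is_CInt_unique (gam : R -> C) (a b : R) (l : C) :
  @is_RInt C_R_NormedModule gam a b l -> CInt gam a b = l.
Proof. apply (is_RInt_unique (V:=C_R_CompleteNormedModule)). Qed.

Lemma continuous_curve_mult (f g : R -> C) (a b : R) :
  continuous_curve f a b -> continuous_curve g a b ->
  continuous_curve (fun t => f t * g t) a b.
Proof.
  intros Hf Hg t Ht. apply continuous_Cmult; [apply Hf|apply Hg]; exact Ht.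
Qed.

Lemma continuous_curve_comp (f : C -> C) (gam : R -> C) (a b : R) :
  (forall t, (a <= t <= b)%R -> exists l, is_cderive f (gam t) l) ->
  continuous_curve gam a b -> continuous_curve (fun t => f (gam t)) a b.
Proof.
  intros Hf Hg t Ht. destruct (Hf t Ht) as [l Hl].
  apply (continuous_comp gam f); [exact (Hg t Ht)|].
  exact (is_cderive_continuous f (gam t) l Hl).
Qed.

Lemma continuous_curve_derive (gam dgam : R -> C) (a b : R) :
  (forall t, (a <= t <= b)%R -> is_curve_derive gam t (dgam t)) ->
  continuous_curve gam a b.
Proof.
  intros H t Ht.
  apply (ex_derive_continuous (K:=R_AbsRing) (V:=C_R_NormedModule)).
  exists (dgam t). exact (H t Ht).
Qed.

Lemma continuous_curve_sub (gam : R -> C) (a b c d : R) :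
  continuous_curve gam a b -> (a <= c)%R -> (d <= b)%R ->
  continuous_curve gam c d.
Proof. intros H Hc Hd t Ht. apply H. lra. Qed.

Lemma CInt_Chasles (gam : R -> C) (a b c : R) : (a <= b <= c)%R ->
  continuous_curve gam a c -> CInt gam a c = CInt gam a b + CInt gam b c.
Proof.
  intros [Hab Hbc] H. symmetry.
  apply (RInt_Chasles (V:=C_R_CompleteNormedModule));
    apply ex_CInt; try assumption;
    apply (continuous_curve_sub gam a c); trivial; lra.
Qed.

Lemma CInt_ext (f g : R -> C) (a b : R) : (a <= b)%R ->
  (forall t, (a <= t <= b)%R -> f t = g t) -> CInt f a b = CInt g a b.
Proof.
  intros Hab H. apply (RInt_ext (V:=C_R_CompleteNormedModule)).
  intros t. rewrite Rmin_left, Rmax_right by exact Hab. intros Ht.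
  apply H. lra.
Qed.

Lemma CInt_derive (gam dgam : R -> C) (a b : R) : (a <= b)%R ->
  (forall t, (a <= t <= b)%R -> is_curve_derive gam t (dgam t)) ->
  continuous_curve dgam a b ->
  @is_RInt C_R_NormedModule dgam a b (gam b - gam a).
Proof.
  intros Hab Hd Hc.
  apply (is_RInt_derive (V:=C_R_CompleteNormedModule) gam dgam);
    rewrite Rmin_left, Rmax_right by exact Hab; assumption.
Qed.

Lemma is_CInt_minus (f g : R -> C) (a b : R) (lf lg : C) :
  @is_RInt C_R_NormedModule f a b lf -> @is_RInt C_R_NormedModule g a b lg ->
  @is_RInt C_R_NormedModule (fun t => f t - g t) a b (lf - lg).
Proof. exact (is_RInt_minus (V:=C_R_NormedModule) f g a b lf lg). Qed.

Lemma is_CInt_bound (f : R -> C) (a b M : R) (l : C) : (a <= b)%R ->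
  (forall t, (a <= t <= b)%R -> (Cmod (f t) <= M)%R) ->
  @is_RInt C_R_NormedModule f a b l -> (Cmod l <= (b - a) * M)%R.
Proof.
  intros Hab H Hi. rewrite <- norm_curve.
  apply (norm_RInt_le_const (V:=C_R_NormedModule) f a b l M Hab); [|exact Hi].
  intros t Ht. rewrite norm_curve. exact (H t Ht).
Qed.

Lemma is_CInt_scal (f : R -> C) (a b : R) (c l : C) :
  @is_RInt C_R_NormedModule f a b l ->
  @is_RInt C_R_NormedModule (fun t => c * f t) a b (c * l).
Proof.
  intros H.
  assert (H1 := is_RInt_fct_extend_fst (U:=R_NormedModule) (V:=R_NormedModule) f a b l H).
  assert (H2 := is_RInt_fct_extend_snd (U:=R_NormedModule) (V:=R_NormedModule) f a b l H).
  apply (is_RInt_fct_extend_pair (U:=R_NormedModule) (V:=R_NormedModule)).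
  - apply (is_RInt_minus (V:=R_NormedModule));
      apply (is_RInt_scal (V:=R_NormedModule)); assumption.
  - apply (is_RInt_plus (V:=R_NormedModule));
      apply (is_RInt_scal (V:=R_NormedModule)); assumption.
Qed.

Definition path_integral (F : C -> C) (gam dgam : R -> C) (a b : R) : C :=
  CInt (fun t => F (gam t) * dgam t) a b.

Lemma curve_increment_le (gam dgam : R -> C) (a b K : R) : (a <= b)%R ->
  (forall t, (a <= t <= b)%R -> is_curve_derive gam t (dgam t)) ->
  continuous_curve dgam a b ->
  (forall t, (a <= t <= b)%R -> (Cmod (dgam t) <= K)%R) ->
  (Cmod (gam b - gam a) <= (b - a) * K)%R.
Proof.
  intros Hab Hd Hc HK.
  exact (is_CInt_bound dgam a b K _ Hab HK (CInt_derive gam dgam a b Hab Hd Hc)).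
Qed.

Definition affine_primitive (A B w : C) : C := A * w + B * (w * w) * / RtoC 2.

Lemma is_cderive_affine_primitive (A B w : C) :
  is_cderive (affine_primitive A B) w (A + B * w).
Proof.
  unfold affine_primitive. eapply is_cderive_eq.
  - apply is_cderive_plus.
    + apply is_cderive_mult; [apply is_cderive_const|apply is_cderive_id].
    + apply is_cderive_mult; [|apply is_cderive_const].
      apply is_cderive_mult; [apply is_cderive_const|].
      apply is_cderive_mult; apply is_cderive_id.
  - cbv beta. field.
Qed.

(** Along a path on which F is within eta of an affine function, the integral
    of F is the increment of the primitive of that function up to eta times
    the length. Around a closed contour the increments cancel and only the
    error remains: this is the analytic input of Goursat's argument, and it
    also differentiates primitives. *)
Lemma path_integral_affine_approx (F : C -> C) (gam dgam : R -> C)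
    (a b K eta : R) (A B : C) :
  (a <= b)%R ->
  (forall t, (a <= t <= b)%R -> is_curve_derive gam t (dgam t)) ->
  continuous_curve dgam a b ->
  (forall t, (a <= t <= b)%R -> (Cmod (dgam t) <= K)%R) ->
  continuous_curve (fun t => F (gam t)) a b ->
  (forall t, (a <= t <= b)%R -> (Cmod (F (gam t) - (A + B * gam t)) <= eta)%R) ->
  (Cmod (path_integral F gam dgam a b -
     (affine_primitive A B (gam b) - affine_primitive A B (gam a)))
   <= (b - a) * (eta * K))%R.
Proof.
  intros Hab Hd Hc HK HF He.
  eapply is_CInt_bound; [exact Hab| |apply is_CInt_minus].
  3: { apply (CInt_derive (fun t => affine_primitive A B (gam t))
               (fun t => dgam t * (A + B * gam t)) a b Hab).
       - intros t Ht. apply is_cderive_curve; [|exact (Hd t Ht)].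
         apply is_cderive_affine_primitive.
       - apply continuous_curve_mult; [exact Hc|].
         apply (continuous_curve_comp (fun w => A + B * w)).
         + intros t _. eexists. apply is_cderive_plus; [apply is_cderive_const|].
           apply is_cderive_mult; [apply is_cderive_const|apply is_cderive_id].
         + exact (continuous_curve_derive gam dgam a b Hd). }
  2: { apply (is_CInt (fun t => F (gam t) * dgam t)); [exact Hab|].
       apply continuous_curve_mult; assumption. }
  intros t Ht. cbv beta.
  replace (F (gam t) * dgam t - dgam t * (A + B * gam t))
    with ((F (gam t) - (A + B * gam t)) * dgam t) by ring.
  rewrite Cmod_mult.
  apply Rmult_le_compat; try apply Cmod_ge_0; [apply He|apply HK]; exact Ht.
Qed.

Lemma continuous_curve_bounded (gam : R -> C) (a b : R) : (a <= b)%R ->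
  continuous_curve gam a b ->
  exists M, (0 < M)%R /\ forall t, (a <= t <= b)%R -> (Cmod (gam t) <= M)%R.
Proof.
  intros Hab H.
  destruct (continuity_ab_maj (fun t => Cmod (gam t)) a b Hab) as [m [Hm _]].
  - intros t Ht. apply continuity_pt_filterlim.
    apply (filterlim_ext (fun t => @norm R_AbsRing C_R_NormedModule (gam t))).
    { intros x. apply norm_curve. }
    rewrite <- norm_curve.
    apply (continuous_comp gam (fun z : C_R_NormedModule => norm z)); [exact (H t Ht)|].
    apply (filterlim_norm (V:=C_R_NormedModule)).
  - exists (Cmod (gam m) + 1)%R. split.
    + generalize (Cmod_ge_0 (gam m)). lra.
    + intros t Ht. generalize (Hm t Ht). lra.
Qed.

Lemma is_curve_derive_const (c : C) (t : R) : is_curve_derive (fun _ => c) t 0.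
Proof. exact (is_derive_const (K:=R_AbsRing) (V:=C_R_NormedModule) c t). Qed.

Lemma is_curve_derive_plus (f g : R -> C) (t : R) (l m : C) :
  is_curve_derive f t l -> is_curve_derive g t m ->
  is_curve_derive (fun u => f u + g u) t (l + m).
Proof. exact (is_derive_plus (K:=R_AbsRing) (V:=C_R_NormedModule) f g t l m). Qed.

Lemma is_curve_derive_RtoC (t : R) : is_curve_derive RtoC t 1.
Proof.
  apply (is_derive_ext (K:=R_AbsRing) (V:=C_R_NormedModule)
           (fun u : R => @scal R_AbsRing C_R_NormedModule u (RtoC 1))).
  - intros u. rewrite scal_R_Cmult. apply Cmult_1_r.
  - assert (H := is_derive_scal_l (K:=R_AbsRing) (V:=C_R_NormedModule)
      (fun u => u) t _ (RtoC 1) (is_derive_id (K:=R_AbsRing) t)).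
    rewrite scal_R_Cmult in H.
    change (RtoC one * RtoC 1) with (1 * 1) in H. rewrite Cmult_1_l in H. exact H.
Qed.

Lemma is_curve_derive_affine (a b : C) (t : R) :
  is_curve_derive (fun u => a + RtoC u * b) t b.
Proof.
  assert (H := is_cderive_curve (fun w => a + w * b) RtoC t b 1).
  rewrite Cmult_1_l in H. apply H.
  - eapply is_cderive_eq.
    + apply is_cderive_plus; [apply is_cderive_const|].
      apply is_cderive_mult; [apply is_cderive_id|apply is_cderive_const].
    + cbv beta. ring.
  - apply is_curve_derive_RtoC.
Qed.

Lemma continuous_curve_const (c : C) (a b : R) : continuous_curve (fun _ => c) a b.
Proof. intros t _. apply continuous_const. Qed.

Lemma continuous_curve_plus (f g : R -> C) (a b : R) :
  continuous_curve f a b -> continuous_curve g a b ->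
  continuous_curve (fun t => f t + g t) a b.
Proof.
  intros Hf Hg t Ht.
  exact (continuous_plus (V:=C_R_NormedModule) f g t (Hf t Ht) (Hg t Ht)).
Qed.

(** * Goursat's bisection *)

Record rect := Rect { lft : R; rgt : R; bot : R; top : R }.

Definition quarter_ll q := Rect (lft q) ((lft q + rgt q) / 2) (bot q) ((bot q + top q) / 2).
Definition quarter_rl q := Rect ((lft q + rgt q) / 2) (rgt q) (bot q) ((bot q + top q) / 2).
Definition quarter_lu q := Rect (lft q) ((lft q + rgt q) / 2) ((bot q + top q) / 2) (top q).
Definition quarter_ru q := Rect ((lft q + rgt q) / 2) (rgt q) ((bot q + top q) / 2) (top q).

Definition is_rect q := (lft q <= rgt q)%R /\ (bot q <= top q)%R.
Definition sub_rect q q' :=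
  (lft q' <= lft q)%R /\ (rgt q <= rgt q')%R /\ (bot q' <= bot q)%R /\ (top q <= top q')%R.
Definition in_rect q s t := (lft q <= s <= rgt q)%R /\ (bot q <= t <= top q)%R.

(** The comparison with the four quarters is decidable, so the nested sequence
    is defined by recursion, with no choice of rectangles. *)
Definition worst_quarter (E : rect -> C) (q : rect) : rect :=
  if Rle_dec (Cmod (E q)) (4 * Cmod (E (quarter_ll q))) then quarter_ll q else
  if Rle_dec (Cmod (E q)) (4 * Cmod (E (quarter_rl q))) then quarter_rl q else
  if Rle_dec (Cmod (E q)) (4 * Cmod (E (quarter_lu q))) then quarter_lu q else
  quarter_ru q.

Lemma worst_quarter_size (E : rect -> C) (q : rect) : is_rect q ->
  let q' := worst_quarter E q in
  sub_rect q' q /\ is_rect q' /\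
  (rgt q' - lft q' = (rgt q - lft q) / 2)%R /\
  (top q' - bot q' = (top q - bot q) / 2)%R.
Proof.
  intros [H1 H2]. unfold worst_quarter, sub_rect, is_rect.
  repeat destruct (Rle_dec _ _); simpl; repeat split; lra.
Qed.

Lemma worst_quarter_le (E : rect -> C) (q : rect) :
  E q = E (quarter_ll q) + E (quarter_rl q) + E (quarter_lu q) + E (quarter_ru q) ->
  (Cmod (E q) <= 4 * Cmod (E (worst_quarter E q)))%R.
Proof.
  intros HE.
  assert (T : (Cmod (E q) <= Cmod (E (quarter_ll q)) + Cmod (E (quarter_rl q))
            + Cmod (E (quarter_lu q)) + Cmod (E (quarter_ru q)))%R).
  { rewrite HE at 1.
    eapply Rle_trans; [apply Cmod_triangle|apply Rplus_le_compat_r].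
    eapply Rle_trans; [apply Cmod_triangle|apply Rplus_le_compat_r].
    apply Cmod_triangle. }
  unfold worst_quarter. repeat destruct (Rle_dec _ _); lra.
Qed.

Lemma nested_intervals (a b : nat -> R) :
  (forall n, a n <= a (S n))%R -> (forall n, b (S n) <= b n)%R ->
  (forall n, a n <= b n)%R -> exists x, forall n, (a n <= x <= b n)%R.
Proof.
  intros Ha Hb Hab.
  assert (Ha' : forall n k, (a n <= a (n + k)%nat)%R).
  { intros n k. induction k; [rewrite Nat.add_0_r; lra|].
    rewrite Nat.add_succ_r. specialize (Ha (n + k)%nat). lra. }
  assert (Hb' : forall n k, (b (n + k)%nat <= b n)%R).
  { intros n k. induction k; [rewrite Nat.add_0_r; lra|].
    rewrite Nat.add_succ_r. specialize (Hb (n + k)%nat). lra. }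
  assert (H : forall n m, (a n <= b m)%R).
  { intros n m. generalize (Ha' n m) (Hb' m n) (Hab (n + m)%nat).
    rewrite (Nat.add_comm m n). lra. }
  destruct (completeness (fun y => exists n, y = a n)) as [x [Hx1 Hx2]].
  - exists (b 0%nat). intros y [n ->]. apply H.
  - exists (a 0%nat), 0%nat. reflexivity.
  - exists x. intros n. split.
    + apply Hx1. exists n. reflexivity.
    + apply Hx2. intros y [m ->]. apply H.
Qed.

(** Goursat's bisection. If E Q were not 0, choosing again and again the quarter
    on which E is largest gives rectangles shrinking to a point with
    |E| >= |E Q| / 4^n, while the local bound there is
    eps times the square of the size, that is eps L^2 / 4^n. *)
Lemma bisection_zero (E : rect -> C) (Q : rect) :
  is_rect Q ->
  (forall q, is_rect q -> sub_rect q Q ->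
     E q = E (quarter_ll q) + E (quarter_rl q) + E (quarter_lu q) + E (quarter_ru q)) ->
  (forall s t eps, in_rect Q s t -> (0 < eps)%R -> exists d, (0 < d)%R /\
     forall q, is_rect q -> sub_rect q Q -> in_rect q s t ->
       ((rgt q - lft q) + (top q - bot q) < d)%R ->
       (Cmod (E q) <= eps * ((rgt q - lft q) + (top q - bot q)) ^ 2)%R) ->
  E Q = 0.
Proof.
  intros HQ Hadd Hloc.
  destruct (Ceq_dec (E Q) 0) as [H0|H0]; [exact H0|exfalso].
  apply Cmod_gt_0 in H0.
  (* L n is the half-perimeter of the n-th rectangle. *)
  set (p := fix p n := match n with O => Q | S n => worst_quarter E (p n) end).
  set (L n := ((rgt (p n) - lft (p n)) + (top (p n) - bot (p n)))%R).
  assert (Hp : forall n, is_rect (p n) /\ sub_rect (p n) Q /\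
    L n = (L O / 2 ^ n)%R /\ (Cmod (E Q) <= 4 ^ n * Cmod (E (p n)))%R).
  { induction n as [|n [IH1 [IH2 [IH3 IH4]]]].
    - unfold L, sub_rect. simpl. repeat split; try apply HQ; try lra.
    - destruct (worst_quarter_size E (p n) IH1) as [S1 [S2 [S3 S4]]].
      generalize (worst_quarter_le E (p n) (Hadd _ IH1 IH2)). intros S5.
      change (worst_quarter E (p n)) with (p (S n)) in *.
      split; [exact S2|]. split; [unfold sub_rect in *; lra|]. split.
      + unfold L at 1. rewrite S3, S4. transitivity (L n / 2)%R.
        * unfold L. field.
        * rewrite IH3. simpl. field. apply pow_nonzero. lra.
      + assert (H4 : (0 < 4 ^ n)%R) by (apply pow_lt; lra).
        apply Rmult_le_compat_l with (r := (4 ^ n)%R) in S5; [|lra].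
        change (4 ^ S n)%R with (4 * 4 ^ n)%R. lra. }
  assert (Hsub : forall n, sub_rect (p (S n)) (p n)).
  { intros n. apply (worst_quarter_size E (p n)). apply Hp. }
  destruct (nested_intervals (fun n => lft (p n)) (fun n => rgt (p n))) as [s Hs];
    try (intros n; apply Hsub); try (intros n; apply Hp).
  destruct (nested_intervals (fun n => bot (p n)) (fun n => top (p n))) as [t Ht];
    try (intros n; apply Hsub); try (intros n; apply Hp).
  assert (HL0 : (0 <= L O)%R) by (unfold L, is_rect in *; simpl; lra).
  set (eps := (Cmod (E Q) / (2 * (L O + 1) ^ 2))%R).
  assert (HLp : (0 < (L O + 1) ^ 2)%R) by (apply pow_lt; lra).
  assert (Heps : (0 < eps)%R) by (apply Rdiv_lt_0_compat; lra).
  destruct (Hloc s t eps (conj (Hs O) (Ht O)) Heps) as [d [Hd Hd']].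
  destruct (pow_lt_1_zero (1/2) ltac:(rewrite Rabs_pos_eq; lra) (d / (L O + 1))%R)
    as [n Hn].
  { apply Rdiv_lt_0_compat; lra. }
  specialize (Hn n (le_n n)).
  rewrite Rabs_pos_eq in Hn by (apply pow_le; lra).
  destruct (Hp n) as [P1 [P2 [P3 P4]]].
  assert (H2n : (0 < 2 ^ n)%R) by (apply pow_lt; lra).
  assert (Hhalf : ((1/2) ^ n = / 2 ^ n)%R).
  { rewrite <- pow_inv. f_equal. lra. }
  rewrite Hhalf in Hn.
  assert (Hsmall : (L n < d)%R).
  { rewrite P3. unfold Rdiv at 1.
    assert (0 < / 2 ^ n)%R by (apply Rinv_0_lt_compat; exact H2n).
    apply Rle_lt_trans with ((L O + 1) * / 2 ^ n)%R; [nra|].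
    apply Rmult_lt_compat_l with (r := (L O + 1)%R) in Hn; [|lra].
    replace ((L O + 1) * (d / (L O + 1)))%R with d in Hn by (field; lra). exact Hn. }
  generalize (Hd' (p n) P1 P2 (conj (Hs n) (Ht n)) Hsmall). fold (L n).
  rewrite P3. intros HE.
  assert (H4 : (4 ^ n = 2 ^ n * 2 ^ n)%R).
  { rewrite <- Rpow_mult_distr. f_equal; lra. }
  assert (HF : (Cmod (E Q) <= eps * L O ^ 2)%R).
  { eapply Rle_trans; [exact P4|]. rewrite H4.
    eapply Rle_trans; [apply Rmult_le_compat_l; [|exact HE]; nra|].
    right. field. lra. }
  assert ((eps * L O ^ 2 <= eps * (L O + 1) ^ 2)%R) by (apply Rmult_le_compat_l; nra).
  assert ((eps * (L O + 1) ^ 2 = Cmod (E Q) / 2)%R) by (unfold eps; field; lra).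
  lra.
Qed.

(** The integral of the form F(zeta) dzeta over the image under a map Gam of the
    boundary of a rectangle. Gs and Gt are the partial derivatives of Gam. *)
Section Homotopy.
Variables (F : C -> C) (Gam Gs Gt : R -> R -> C).

Definition boundary_integral (q : rect) : C :=
  path_integral F (fun s => Gam s (bot q)) (fun s => Gs s (bot q)) (lft q) (rgt q)
  + path_integral F (Gam (rgt q)) (Gt (rgt q)) (bot q) (top q)
  - path_integral F (fun s => Gam s (top q)) (fun s => Gs s (top q)) (lft q) (rgt q)
  - path_integral F (Gam (lft q)) (Gt (lft q)) (bot q) (top q).

Variables (Q : rect) (K : R).
Hypothesis HQ : is_rect Q.
Hypothesis HGs : forall s t, in_rect Q s t ->
  is_curve_derive (fun s => Gam s t) s (Gs s t) /\ (Cmod (Gs s t) <= K)%R /\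
  @continuous R_UniformSpace C_UniformSpace (fun s => Gs s t) s.
Hypothesis HGt : forall s t, in_rect Q s t ->
  is_curve_derive (Gam s) t (Gt s t) /\ (Cmod (Gt s t) <= K)%R /\
  @continuous R_UniformSpace C_UniformSpace (Gt s) t.
Hypothesis HF : forall s t, in_rect Q s t -> exists l, is_cderive F (Gam s t) l.

Lemma Gam_lipschitz (q : rect) (s t s' t' : R) : is_rect q -> sub_rect q Q ->
  in_rect q s t -> in_rect q s' t' ->
  (Cmod (Gam s' t' - Gam s t) <= K * ((rgt q - lft q) + (top q - bot q)))%R.
Proof.
  intros Hq Hsub Hst Hst'. unfold is_rect, sub_rect, in_rect in *.
  assert (HK : (0 <= K)%R).
  { destruct (HGs s t) as [_ [H _]]; [lra|]. generalize (Cmod_ge_0 (Gs s t)). lra. }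
  assert (Hs : forall a b u, (lft q <= a <= b)%R -> (b <= rgt q)%R -> (bot q <= u <= top q)%R ->
     (Cmod (Gam b u - Gam a u) <= (b - a) * K)%R).
  { intros a b u Ha Hb Hu.
    apply (curve_increment_le (fun s => Gam s u) (fun s => Gs s u)); [lra|..];
      intros v Hv; apply HGs; lra. }
  assert (Ht : forall a b u, (bot q <= a <= b)%R -> (b <= top q)%R -> (lft q <= u <= rgt q)%R ->
     (Cmod (Gam u b - Gam u a) <= (b - a) * K)%R).
  { intros a b u Ha Hb Hu.
    apply (curve_increment_le (Gam u) (Gt u)); [lra|..];
      intros v Hv; apply HGt; lra. }
  replace (Gam s' t' - Gam s t) with ((Gam s' t' - Gam s t') + (Gam s t' - Gam s t)) by ring.
  eapply Rle_trans; [apply Cmod_triangle|].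
  rewrite Rmult_plus_distr_l. apply Rplus_le_compat.
  - destruct (Rle_dec s s').
    + eapply Rle_trans; [apply Hs; lra|]. nra.
    + rewrite Cmod_minus_sym. eapply Rle_trans; [apply Hs; lra|]. nra.
  - destruct (Rle_dec t t').
    + eapply Rle_trans; [apply Ht; lra|]. nra.
    + rewrite Cmod_minus_sym. eapply Rle_trans; [apply Ht; lra|]. nra.
Qed.

Lemma horizontal_continuous t : (bot Q <= t <= top Q)%R ->
  continuous_curve (fun s => F (Gam s t)) (lft Q) (rgt Q) /\
  continuous_curve (fun s => Gs s t) (lft Q) (rgt Q).
Proof.
  intros Ht. split.
  - apply continuous_curve_comp.
    + intros s Hs. apply HF. split; assumption.
    + apply (continuous_curve_derive _ (fun s => Gs s t)).
      intros s Hs. apply HGs. split; assumption.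
  - intros s Hs. apply HGs. split; assumption.
Qed.

Lemma vertical_continuous s : (lft Q <= s <= rgt Q)%R ->
  continuous_curve (fun t => F (Gam s t)) (bot Q) (top Q) /\
  continuous_curve (Gt s) (bot Q) (top Q).
Proof.
  intros Hs. split.
  - apply continuous_curve_comp.
    + intros t Ht. apply HF. split; assumption.
    + apply (continuous_curve_derive _ (Gt s)).
      intros t Ht. apply HGt. split; assumption.
  - intros t Ht. apply HGt. split; assumption.
Qed.

Lemma horizontal_Chasles a b c t : (lft Q <= a)%R -> (a <= b <= c)%R -> (c <= rgt Q)%R ->
  (bot Q <= t <= top Q)%R ->
  path_integral F (fun s => Gam s t) (fun s => Gs s t) a c =
  path_integral F (fun s => Gam s t) (fun s => Gs s t) a b +
  path_integral F (fun s => Gam s t) (fun s => Gs s t) b c.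
Proof.
  intros Ha Hb Hc Ht. apply CInt_Chasles; [exact Hb|].
  destruct (horizontal_continuous t Ht) as [H1 H2].
  apply (continuous_curve_sub _ (lft Q) (rgt Q)); [|lra|lra].
  apply continuous_curve_mult; assumption.
Qed.

Lemma vertical_Chasles a b c s : (bot Q <= a)%R -> (a <= b <= c)%R -> (c <= top Q)%R ->
  (lft Q <= s <= rgt Q)%R ->
  path_integral F (Gam s) (Gt s) a c =
  path_integral F (Gam s) (Gt s) a b + path_integral F (Gam s) (Gt s) b c.
Proof.
  intros Ha Hb Hc Hs. apply CInt_Chasles; [exact Hb|].
  destruct (vertical_continuous s Hs) as [H1 H2].
  apply (continuous_curve_sub _ (bot Q) (top Q)); [|lra|lra].
  apply continuous_curve_mult; assumption.
Qed.

Lemma boundary_integral_additive (q : rect) : is_rect q -> sub_rect q Q ->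
  boundary_integral q = boundary_integral (quarter_ll q) + boundary_integral (quarter_rl q)
   + boundary_integral (quarter_lu q) + boundary_integral (quarter_ru q).
Proof.
  intros Hq Hs. unfold is_rect, sub_rect in *.
  unfold boundary_integral; simpl.
  set (m := ((lft q + rgt q) / 2)%R). set (n := ((bot q + top q) / 2)%R).
  assert (Hm : (lft q <= m <= rgt q)%R) by (unfold m; lra).
  assert (Hn : (bot q <= n <= top q)%R) by (unfold n; lra).
  rewrite (horizontal_Chasles (lft q) m (rgt q) (bot q)) by lra.
  rewrite (horizontal_Chasles (lft q) m (rgt q) (top q)) by lra.
  rewrite (vertical_Chasles (bot q) n (top q) (lft q)) by lra.
  rewrite (vertical_Chasles (bot q) n (top q) (rgt q)) by lra.
  ring.
Qed.

(** Near s, t the function F is affine up to e |zeta - z|, which is at most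
    e K l on a rectangle of size l; each side then contributes an error of
    order e K^2 l^2, and the increments of the primitive cancel. *)
Lemma boundary_integral_local (s t eps : R) : in_rect Q s t -> (0 < eps)%R ->
  exists d, (0 < d)%R /\ forall q, is_rect q -> sub_rect q Q -> in_rect q s t ->
    ((rgt q - lft q) + (top q - bot q) < d)%R ->
    (Cmod (boundary_integral q) <= eps * ((rgt q - lft q) + (top q - bot q)) ^ 2)%R.
Proof.
  intros Hst Heps.
  destruct (HF s t Hst) as [B HB]. set (z := Gam s t) in *.
  assert (HK : (0 <= K)%R).
  { destruct (HGs s t Hst) as [_ [H _]]. generalize (Cmod_ge_0 (Gs s t)). lra. }
  set (e := (eps / (2 * (K * K + 1)))%R).
  assert (He : (0 < e)%R) by (apply Rdiv_lt_0_compat; nra).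
  destruct (proj1 (is_cderive_eps F z B) HB e He) as [d [Hd Hd']].
  exists (d / (K + 1))%R. split; [apply Rdiv_lt_0_compat; lra|].
  intros q Hq Hsub Hin. set (l := ((rgt q - lft q) + (top q - bot q))%R). intros Hl.
  assert (Hl0 : (0 <= l)%R) by (unfold l, is_rect in *; lra).
  assert (Happrox : forall s' t', in_rect q s' t' ->
    (Cmod (F (Gam s' t') - (F z - B * z + B * Gam s' t')) <= e * (K * l))%R).
  { intros s' t' H'.
    assert (HL := Gam_lipschitz q s t s' t' Hq Hsub Hin H'). fold z l in HL.
    replace (F (Gam s' t') - (F z - B * z + B * Gam s' t'))
      with (F (Gam s' t') - F z - (Gam s' t' - z) * B) by ring.
    assert (Hlt : (Cmod (Gam s' t' - z) < d)%R).
    { eapply Rle_lt_trans; [exact HL|].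
      apply Rmult_lt_compat_r with (r := (K + 1)%R) in Hl; [|lra].
      replace (d / (K + 1) * (K + 1))%R with d in Hl by (field; lra).
      nra. }
    eapply Rle_trans; [exact (Hd' _ Hlt)|]. apply Rmult_le_compat_l; lra. }
  set (A := F z - B * z) in *. set (P := affine_primitive A B).
  unfold is_rect, sub_rect, in_rect in *.
  assert (Hh : forall u, (bot q <= u <= top q)%R ->
    (Cmod (path_integral F (fun s => Gam s u) (fun s => Gs s u) (lft q) (rgt q)
      - (P (Gam (rgt q) u) - P (Gam (lft q) u))) <= (rgt q - lft q) * (e * (K * l) * K))%R).
  { intros u Hu. destruct (horizontal_continuous u) as [C1 C2]; [lra|].
    apply (path_integral_affine_approx F (fun s => Gam s u) (fun s => Gs s u)); [lra|..].
    - intros v Hv. apply HGs. unfold in_rect; lra.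
    - apply (continuous_curve_sub _ (lft Q) (rgt Q)); [exact C2|lra|lra].
    - intros v Hv. apply HGs. unfold in_rect; lra.
    - apply (continuous_curve_sub _ (lft Q) (rgt Q)); [exact C1|lra|lra].
    - intros v Hv. apply Happrox. lra. }
  assert (Hv : forall u, (lft q <= u <= rgt q)%R ->
    (Cmod (path_integral F (Gam u) (Gt u) (bot q) (top q)
      - (P (Gam u (top q)) - P (Gam u (bot q)))) <= (top q - bot q) * (e * (K * l) * K))%R).
  { intros u Hu. destruct (vertical_continuous u) as [C1 C2]; [lra|].
    apply (path_integral_affine_approx F (Gam u) (Gt u)); [lra|..].
    - intros v Hv. apply HGt. unfold in_rect; lra.
    - apply (continuous_curve_sub _ (bot Q) (top Q)); [exact C2|lra|lra].
    - intros v Hv. apply HGt. unfold in_rect; lra.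
    - apply (continuous_curve_sub _ (bot Q) (top Q)); [exact C1|lra|lra].
    - intros v Hv. apply Happrox. lra. }
  assert (H1 := Hh (bot q) ltac:(lra)). assert (H2 := Hh (top q) ltac:(lra)).
  assert (H3 := Hv (rgt q) ltac:(lra)). assert (H4 := Hv (lft q) ltac:(lra)).
  clear Hh Hv. cbv beta in *. unfold boundary_integral.
  match type of H1 with (Cmod ?x <= _)%R => set (x1 := x) in * end.
  match type of H2 with (Cmod ?x <= _)%R => set (x2 := x) in * end.
  match type of H3 with (Cmod ?x <= _)%R => set (x3 := x) in * end.
  match type of H4 with (Cmod ?x <= _)%R => set (x4 := x) in * end.
  match goal with |- (Cmod ?x <= _)%R => replace x with ((x1 + x3) - (x2 + x4)) end.
  2: { unfold x1, x2, x3, x4. ring. }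
  eapply Rle_trans; [apply Cmod_triangle|]. rewrite Cmod_opp.
  generalize (Cmod_triangle x1 x3) (Cmod_triangle x2 x4). intros T1 T2.
  apply Rle_trans with (2 * l * (e * (K * l) * K))%R; [unfold l at 1; lra|].
  apply Rle_trans with (2 * e * (K * K + 1) * (l * l))%R.
  { assert (0 <= e * (l * l))%R by (apply Rmult_le_pos; nra). nra. }
  right. unfold e. field. nra.
Qed.

(** Cauchy's theorem in homotopy form. F is assumed complex differentiable at
    each point of the image only, hence the bisection instead of Green's
    formula. *)
Theorem boundary_integral_zero : boundary_integral Q = 0.
Proof.
  apply bisection_zero; [exact HQ| |].
  - exact boundary_integral_additive.
  - exact boundary_integral_local.
Qed.
End Homotopy.

(** * Deformation of contours *)

(** Cauchy's theorem for a homotopy moving each point u t along the vector v t.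
    Every deformation of contours below is of this form: shrinking a circle to
    a point inside, comparing concentric circles, comparing two segments
    issued from 0. *)
Lemma line_homotopy (F : C -> C) (u du v dv : R -> C) (a b sig tau : R) :
  (a <= b)%R -> (sig <= tau)%R ->
  (forall t, (a <= t <= b)%R -> is_curve_derive u t (du t)) ->
  (forall t, (a <= t <= b)%R -> is_curve_derive v t (dv t)) ->
  continuous_curve du a b -> continuous_curve dv a b ->
  (forall s t, (sig <= s <= tau)%R -> (a <= t <= b)%R ->
     exists l, is_cderive F (u t + RtoC s * v t) l) ->
  let edge t := path_integral F (fun s => u t + RtoC s * v t) (fun _ => v t) sig tau in
  let slice s := path_integral F (fun t => u t + RtoC s * v t)
                   (fun t => du t + RtoC s * dv t) a b in
  edge a + slice tau = edge b + slice sig.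
Proof.
  intros Hab Hst Hu Hv Hdu Hdv HF edge slice.
  destruct (continuous_curve_bounded v a b Hab (continuous_curve_derive v dv a b Hv))
    as [M1 [HM1 B1]].
  destruct (continuous_curve_bounded du a b Hab Hdu) as [M2 [HM2 B2]].
  destruct (continuous_curve_bounded dv a b Hab Hdv) as [M3 [HM3 B3]].
  set (N := (Rabs sig + Rabs tau)%R).
  assert (HN : forall s, (sig <= s <= tau)%R -> (Rabs s <= N)%R).
  { intros s Hs. unfold N, Rabs. repeat destruct Rcase_abs; lra. }
  assert (HN0 : (0 <= N)%R).
  { eapply Rle_trans; [apply Rabs_pos|apply (HN sig); lra]. }
  assert (H : boundary_integral F (fun s t => u t + RtoC s * v t) (fun _ t => v t)
                (fun s t => du t + RtoC s * dv t) (Rect sig tau a b) = 0).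
  { apply (boundary_integral_zero _ _ _ _ _ (M1 + M2 + N * M3)%R).
    - split; simpl; assumption.
    - intros s t [Hs Ht]; simpl in *. split; [|split].
      + apply is_curve_derive_affine.
      + generalize (B1 t Ht). nra.
      + apply continuous_const.
    - intros s t [Hs Ht]; simpl in *. split; [|split].
      + apply is_curve_derive_plus; [apply Hu; exact Ht|].
        rewrite Cmult_comm.
        apply (is_cderive_curve (fun w => RtoC s * w) v t (RtoC s)); [|apply Hv; exact Ht].
        eapply is_cderive_eq.
        * apply is_cderive_mult; [apply is_cderive_const|apply is_cderive_id].
        * cbv beta. ring.
      + eapply Rle_trans; [apply Cmod_triangle|]. rewrite Cmod_mult, Cmod_R.
        generalize (B2 t Ht) (Rmult_le_compat _ _ _ _ (Rabs_pos s) (Cmod_ge_0 (dv t)) (HN s Hs) (B3 t Ht)).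
        lra.
      + apply (continuous_curve_plus du (fun t => RtoC s * dv t) a b); [exact Hdu| |exact Ht].
        apply continuous_curve_mult; [apply continuous_curve_const|exact Hdv].
    - intros s t [Hs Ht]. apply HF; assumption. }
  unfold boundary_integral in H; simpl in H.
  fold (edge a) (edge b) (slice sig) (slice tau) in H.
  replace (edge a + slice tau) with
    ((edge a + slice tau - edge b - slice sig) + (edge b + slice sig)) by ring.
  change (edge a + slice tau - edge b - slice sig = 0) in H.
  rewrite H. ring.
Qed.

(** * Cauchy's integral formula *)

Definition circle (r t : R) : C := RtoC r * cexp (RtoC t * Ci).

Lemma is_curve_derive_circle (r t : R) :
  is_curve_derive (circle r) t (Ci * circle r t).
Proof.
  assert (H := is_cderive_curve (fun w => RtoC r * cexp (w * Ci)) RtoC t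
     (RtoC r * (Ci * cexp (RtoC t * Ci))) 1).
  replace (Ci * circle r t) with (1 * (RtoC r * (Ci * cexp (RtoC t * Ci))))
    by (unfold circle; ring).
  apply H; [|apply is_curve_derive_RtoC].
  eapply is_cderive_eq.
  - apply is_cderive_mult; [apply is_cderive_const|].
    apply (is_cderive_comp cexp (fun w => w * Ci)); [apply is_cderive_cexp|].
    apply is_cderive_mult; [apply is_cderive_id|apply is_cderive_const].
  - cbv beta. ring.
Qed.

Lemma Cmod_circle (r t : R) : (0 <= r)%R -> Cmod (circle r t) = r.
Proof.
  intros Hr. unfold circle. rewrite Cmod_mult, Cmod_cexp, Cmod_R, Rabs_pos_eq by exact Hr.
  replace (Re (RtoC t * Ci)) with 0%R by (unfold Ci, RtoC, Re, Cmult; simpl; ring).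
  rewrite exp_0. ring.
Qed.

Lemma circle_closed (r : R) : circle r 0 = circle r (2 * PI).
Proof.
  unfold circle. f_equal.
  unfold cexp, Ci, RtoC, Re, Im, Cmult; simpl.
  replace (0 * 0 - 0 * 1)%R with 0%R by ring.
  replace (2 * PI * 0 - 0 * 1)%R with 0%R by ring.
  replace (0 * 1 + 0 * 0)%R with 0%R by ring.
  replace (2 * PI * 1 + 0 * 0)%R with (2 * PI)%R by ring.
  rewrite cos_2PI, sin_2PI, cos_0, sin_0. reflexivity.
Qed.

Lemma circle_scal (r t : R) : circle r t = RtoC r * circle 1 t.
Proof. unfold circle. ring. Qed.

Lemma continuous_curve_circle (r a b : R) : continuous_curve (circle r) a b.
Proof.
  apply (continuous_curve_derive _ (fun t => Ci * circle r t)).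
  intros t _. apply is_curve_derive_circle.
Qed.

Lemma continuous_curve_inv (f : R -> C) (a b : R) :
  (forall t, (a <= t <= b)%R -> f t <> 0) -> continuous_curve f a b ->
  continuous_curve (fun t => / f t) a b.
Proof.
  intros H Hf. apply (continuous_curve_comp Cinv); [|exact Hf].
  intros t Ht. eexists. apply is_cderive_inv. apply H; exact Ht.
Qed.

Lemma two_PI_pos : (0 <= 2 * PI)%R.
Proof. generalize PI_RGT_0. lra. Qed.

Lemma CInt_scal (f : R -> C) (a b : R) (c : C) : (a <= b)%R ->
  continuous_curve f a b -> CInt (fun t => c * f t) a b = c * CInt f a b.
Proof.
  intros Hab Hf. apply is_CInt_unique. apply is_CInt_scal. apply is_CInt; assumption.
Qed.

Lemma CInt_minus (f g : R -> C) (a b : R) : (a <= b)%R ->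
  continuous_curve f a b -> continuous_curve g a b ->
  CInt (fun t => f t - g t) a b = CInt f a b - CInt g a b.
Proof.
  intros Hab Hf Hg. apply is_CInt_unique.
  apply is_CInt_minus; apply is_CInt; assumption.
Qed.

Lemma CInt_bound (f : R -> C) (a b M : R) : (a <= b)%R ->
  continuous_curve f a b ->
  (forall t, (a <= t <= b)%R -> (Cmod (f t) <= M)%R) ->
  (Cmod (CInt f a b) <= (b - a) * M)%R.
Proof.
  intros Hab Hf H. apply (is_CInt_bound f); [exact Hab|exact H|].
  apply is_CInt; assumption.
Qed.

Lemma CInt_const (c : C) (a b : R) : CInt (fun _ => c) a b = RtoC (b - a) * c.
Proof.
  apply is_CInt_unique.
  rewrite <- scal_R_Cmult. apply (is_RInt_const (V:=C_R_NormedModule)).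
Qed.

Lemma closed_line_homotopy (F : C -> C) (u du v dv : R -> C) (a b sig tau : R) :
  (a <= b)%R -> (sig <= tau)%R ->
  (forall t, (a <= t <= b)%R -> is_curve_derive u t (du t)) ->
  (forall t, (a <= t <= b)%R -> is_curve_derive v t (dv t)) ->
  continuous_curve du a b -> continuous_curve dv a b ->
  u a = u b -> v a = v b ->
  (forall s t, (sig <= s <= tau)%R -> (a <= t <= b)%R ->
     exists l, is_cderive F (u t + RtoC s * v t) l) ->
  path_integral F (fun t => u t + RtoC tau * v t) (fun t => du t + RtoC tau * dv t) a b =
  path_integral F (fun t => u t + RtoC sig * v t) (fun t => du t + RtoC sig * dv t) a b.
Proof.
  intros Hab Hst Hu Hv Hdu Hdv Eu Ev HF.
  assert (H := line_homotopy F u du v dv a b sig tau Hab Hst Hu Hv Hdu Hdv HF).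
  cbv zeta in H. cbv beta in H. rewrite Eu, Ev in H.
  match type of H with (?x + ?y = _ + ?z) =>
    replace y with (x + y - x) by ring; rewrite H; ring end.
Qed.

Lemma Cmult_Ci_inj (x y : C) : Ci * x = Ci * y -> x = y.
Proof.
  intros E. replace x with (- Ci * (Ci * x)).
  - rewrite E. destruct y; unfold Ci, Cmult, Copp; simpl; f_equal; ring.
  - destruct x; unfold Ci, Cmult, Copp; simpl; f_equal; ring.
Qed.

(** dzeta / (zeta - z) on the circle is i cauchy_kernel dt. *)
Definition cauchy_kernel (r : R) (z : C) (t : R) : C := circle r t * / (circle r t - z).

Lemma circle_minus_neq_0 (r : R) (z : C) (t : R) : (Cmod z < r)%R -> circle r t - z <> 0.
Proof.
  intros Hz E. assert (H := Cmod_minus_ge (circle r t) z).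
  rewrite E, Cmod_0, Cmod_circle in H; generalize (Cmod_ge_0 z); lra.
Qed.

Lemma circle_neq_0 (r t : R) : (0 < r)%R -> circle r t <> 0.
Proof.
  intros Hr. apply Cmod_gt_0. rewrite Cmod_circle; lra.
Qed.

Lemma continuous_curve_minus_const (f : R -> C) (c : C) (a b : R) :
  continuous_curve f a b -> continuous_curve (fun t => f t - c) a b.
Proof.
  intros H. apply (continuous_curve_plus f (fun _ => - c)); [exact H|].
  apply continuous_curve_const.
Qed.

Lemma continuous_cauchy_kernel (r : R) (z : C) (a b : R) : (Cmod z < r)%R ->
  continuous_curve (cauchy_kernel r z) a b.
Proof.
  intros Hz. apply continuous_curve_mult; [apply continuous_curve_circle|].
  apply (continuous_curve_inv (fun t => circle r t - z)).
  - intros t _. apply circle_minus_neq_0. exact Hz.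
  - apply continuous_curve_minus_const. apply continuous_curve_circle.
Qed.

(** The integral of 1 / zeta along the translated circle zeta - s z does not
    depend on s in [0, 1], and at s = 0 its integrand is the constant i. *)
Lemma CInt_cauchy_kernel (r : R) (z : C) : (Cmod z < r)%R ->
  CInt (cauchy_kernel r z) 0 (2 * PI) = RtoC (2 * PI).
Proof.
  intros Hz. assert (Hr : (0 < r)%R) by (generalize (Cmod_ge_0 z); lra).
  assert (H := closed_line_homotopy Cinv (circle r) (fun t => Ci * circle r t)
    (fun _ => - z) (fun _ => 0) 0 (2 * PI) 0 1 two_PI_pos ltac:(lra)
    (fun t _ => is_curve_derive_circle r t) (fun t _ => is_curve_derive_const (- z) t)).
  unfold path_integral in H.
  assert (E1 : CInt (fun t => / (circle r t + 1 * - z) * (Ci * circle r t + 1 * 0)) 0 (2 * PI)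
    = Ci * CInt (cauchy_kernel r z) 0 (2 * PI)).
  { rewrite <- CInt_scal; [|apply two_PI_pos|apply continuous_cauchy_kernel; exact Hz].
    apply CInt_ext; [apply two_PI_pos|]. intros t _. unfold cauchy_kernel.
    replace (circle r t + 1 * - z) with (circle r t - z) by ring. ring. }
  assert (E2 : CInt (fun t => / (circle r t + 0 * - z) * (Ci * circle r t + 0 * 0)) 0 (2 * PI)
    = Ci * RtoC (2 * PI)).
  { rewrite (CInt_ext _ (fun _ => Ci)); [|apply two_PI_pos|].
    - rewrite CInt_const. rewrite Rminus_0_r. ring.
    - intros t _. replace (circle r t + 0 * - z) with (circle r t) by ring.
      field. apply circle_neq_0; exact Hr. }
  rewrite E1, E2 in H.
  apply Cmult_Ci_inj. apply H.
  - apply continuous_curve_mult; [apply continuous_curve_const|apply continuous_curve_circle].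
  - apply continuous_curve_const.
  - apply circle_closed.
  - reflexivity.
  - intros s t Hs _. eexists. apply is_cderive_inv.
    replace (circle r t + RtoC s * - z) with (circle r t - RtoC s * z) by ring.
    apply circle_minus_neq_0. rewrite Cmod_mult, Cmod_R, Rabs_pos_eq by lra.
    generalize (Cmod_ge_0 z). nra.
Qed.

Lemma analytic_cderive (f : C -> C) (z : C) : analytic_on_disk f -> in_disk z ->
  exists l, is_cderive f z l.
Proof. intros H Hz. exact (H z Hz). Qed.

Lemma continuous_on_circle (f : C -> C) (r a b : R) : analytic_on_disk f -> (0 <= r < 1)%R ->
  continuous_curve (fun t => f (circle r t)) a b.
Proof.
  intros Hf Hr. apply continuous_curve_comp; [|apply continuous_curve_circle].
  intros t _. apply analytic_cderive; [exact Hf|]. unfold in_disk.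
  rewrite Cmod_circle; lra.
Qed.

Lemma is_cderive_lipschitz (f : C -> C) (z l : C) : is_cderive f z l ->
  exists L d, (0 < L)%R /\ (0 < d)%R /\ forall y, (Cmod (y - z) < d)%R ->
    (Cmod (f y - f z) <= L * Cmod (y - z))%R.
Proof.
  intros H. destruct (proj1 (is_cderive_eps f z l) H 1%R ltac:(lra)) as [d [Hd Hd']].
  exists (1 + Cmod l)%R, d. split; [generalize (Cmod_ge_0 l); lra|]. split; [exact Hd|].
  intros y Hy. replace (f y - f z) with ((f y - f z - (y - z) * l) + (y - z) * l) by ring.
  eapply Rle_trans; [apply Cmod_triangle|]. rewrite Cmod_mult.
  generalize (Hd' y Hy). lra.
Qed.

(** Contract the circle towards z along segments: the curve
    G s t = z + s (zeta - z) satisfies dG / (G - z) = i cauchy_kernel dt for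
    every s > 0, so homotopy invariance for f(zeta) / (zeta - z) says that the
    integral J s of f (G s t) against the fixed kernel is constant. As s tends
    to 0 the function f (G s t) tends uniformly to f z. *)
Lemma cauchy_formula (f : C -> C) (r : R) (z : C) : analytic_on_disk f ->
  (Cmod z < r < 1)%R ->
  CInt (fun t => f (circle r t) * cauchy_kernel r z t) 0 (2 * PI) = RtoC (2 * PI) * f z.
Proof.
  intros Hf [Hz Hr]. assert (Hz0 := Cmod_ge_0 z).
  set (k := cauchy_kernel r z).
  assert (Hk : continuous_curve k 0 (2 * PI)) by (apply continuous_cauchy_kernel; exact Hz).
  set (G s t := z + RtoC s * (circle r t - z)).
  assert (HG : forall s t, (0 <= s <= 1)%R -> in_disk (G s t)).
  { intros s t Hs. unfold in_disk, G.
    replace (z + RtoC s * (circle r t - z)) with (RtoC (1 - s) * z + RtoC s * circle r t)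
      by (rewrite RtoC_minus; ring).
    eapply Rle_lt_trans; [apply Cmod_triangle|].
    rewrite !Cmod_mult, !Cmod_R, !Rabs_pos_eq, Cmod_circle by lra.
    apply Rle_lt_trans with ((1 - s) * r + s * r)%R; [|lra].
    apply Rplus_le_compat_r, Rmult_le_compat_l; lra. }
  assert (HcG : forall s, (0 <= s <= 1)%R ->
    continuous_curve (fun t => f (G s t) * k t) 0 (2 * PI)).
  { intros s Hs. apply continuous_curve_mult; [|exact Hk].
    apply continuous_curve_comp.
    - intros t _. apply analytic_cderive; [exact Hf|apply HG; exact Hs].
    - apply (continuous_curve_plus (fun _ => z)); [apply continuous_curve_const|].
      apply continuous_curve_mult; [apply continuous_curve_const|].
      apply continuous_curve_minus_const, continuous_curve_circle. }
  set (J s := CInt (fun t => f (G s t) * k t) 0 (2 * PI)).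
  assert (HJ1 : CInt (fun t => f (circle r t) * k t) 0 (2 * PI) = J 1%R).
  { apply CInt_ext; [apply two_PI_pos|]. intros t _. unfold G. do 2 f_equal. ring. }
  rewrite HJ1.
  assert (HJ : forall s, (0 < s <= 1)%R -> J s = J 1%R).
  { intros s Hs.
    assert (Hw : forall sg, (0 < sg <= 1)%R ->
      path_integral (fun w => f w * / (w - z)) (fun t => z + RtoC sg * (circle r t - z))
        (fun t => 0 + RtoC sg * (Ci * circle r t)) 0 (2 * PI) = Ci * J sg).
    { intros sg Hsg. unfold J. rewrite <- CInt_scal; [|apply two_PI_pos|apply HcG; lra].
      apply CInt_ext; [apply two_PI_pos|]. intros t _.
      unfold k, cauchy_kernel, G. field. split.
      - apply circle_minus_neq_0; exact Hz.
      - replace (z + RtoC sg * (circle r t - z) - z) with (RtoC sg * (circle r t - z)) by ring.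
        apply Cmult_neq_0; [|apply circle_minus_neq_0; exact Hz].
        intros E. apply RtoC_inj in E. lra. }
    assert (E : Ci * J 1%R = Ci * J s).
    { rewrite <- !Hw by lra.
      apply (closed_line_homotopy (fun w => f w * / (w - z)) (fun _ => z) (fun _ => 0)
        (fun t => circle r t - z) (fun t => Ci * circle r t)).
      - apply two_PI_pos.
      - lra.
      - intros t _. apply is_curve_derive_const.
      - intros t _. rewrite <- (Cplus_0_r (Ci * circle r t)).
        apply (is_curve_derive_plus (circle r) (fun _ => - z)).
        + apply is_curve_derive_circle.
        + apply is_curve_derive_const.
      - apply continuous_curve_const.
      - apply continuous_curve_mult; [apply continuous_curve_const|apply continuous_curve_circle].
      - reflexivity.
      - rewrite circle_closed. reflexivity.
      - intros s' t Hs' _.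
        destruct (analytic_cderive f (G s' t) Hf) as [l Hl]; [apply HG; lra|].
        eexists. apply is_cderive_mult; [exact Hl|].
        apply (is_cderive_comp Cinv (fun w => w - z)).
        + apply is_cderive_inv. unfold G.
          replace (z + RtoC s' * (circle r t - z) - z) with (RtoC s' * (circle r t - z)) by ring.
          apply Cmult_neq_0; [|apply circle_minus_neq_0; exact Hz].
          intros E. apply RtoC_inj in E. lra.
        + apply (is_cderive_plus (fun w => w) (fun _ => - z));
            [apply is_cderive_id|apply is_cderive_const]. }
    symmetry. exact (Cmult_Ci_inj _ _ E). }
  destruct (continuous_curve_bounded k 0 (2 * PI) two_PI_pos Hk) as [M [HM0 HM]].
  destruct (analytic_cderive f z Hf) as [l Hl]; [unfold in_disk; lra|].
  destruct (is_cderive_lipschitz f z l Hl) as [L [d [HL [Hd Hd']]]].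
  assert (Hest : forall s, (0 < s <= 1)%R -> (s * 2 < d)%R ->
    (Cmod (J 1%R - RtoC (2 * PI) * f z) <= s * (2 * PI * (L * 2 * M)))%R).
  { intros s Hs Hsd.
    rewrite <- (HJ s Hs). rewrite <- (CInt_cauchy_kernel r z Hz). fold k.
    rewrite (Cmult_comm (CInt k 0 (2 * PI))).
    rewrite <- CInt_scal; [|apply two_PI_pos|exact Hk].
    unfold J. rewrite <- CInt_minus; [|apply two_PI_pos|apply HcG; lra|].
    2: { apply continuous_curve_mult; [apply continuous_curve_const|exact Hk]. }
    eapply Rle_trans; [apply CInt_bound with (M := (L * (s * 2) * M)%R)|].
    - apply two_PI_pos.
    - apply (continuous_curve_plus (fun t => f (G s t) * k t) (fun t => - (f z * k t)));
        [apply HcG; lra|].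
      intros t Ht. apply (continuous_opp (V:=C_R_NormedModule)).
      apply (continuous_curve_mult (fun _ => f z) k 0 (2 * PI));
        [apply continuous_curve_const|exact Hk|exact Ht].
    - intros t Ht. replace (f (G s t) * k t - f z * k t) with ((f (G s t) - f z) * k t) by ring.
      rewrite Cmod_mult. apply Rmult_le_compat; try apply Cmod_ge_0; [|apply HM; exact Ht].
      assert (HGz : (Cmod (G s t - z) <= s * 2)%R).
      { unfold G. replace (z + RtoC s * (circle r t - z) - z) with (RtoC s * (circle r t - z)) by ring.
        rewrite Cmod_mult, Cmod_R, Rabs_pos_eq by lra.
        apply Rmult_le_compat_l; [lra|].
        eapply Rle_trans; [apply Cmod_triangle|]. rewrite Cmod_opp, Cmod_circle; lra. }
      eapply Rle_trans; [apply Hd'; lra|]. apply Rmult_le_compat_l; lra.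
    - right. ring. }
  apply Ceq_minus. apply Cmod_eq_0.
  set (c := Cmod (J 1%R - RtoC (2 * PI) * f z)) in *.
  assert (Hc0 : (0 <= c)%R) by apply Cmod_ge_0.
  destruct (Rle_lt_or_eq_dec _ _ Hc0) as [Hpos|]; [exfalso|lra].
  (* A positive distance c would contradict Hest for s with s B < c. *)
  set (B := (2 * PI * (L * 2 * M))%R) in *.
  assert (HB : (0 < B)%R).
  { unfold B. assert (H := PI_RGT_0). assert (0 < L * 2 * M)%R by (repeat apply Rmult_lt_0_compat; lra). apply Rmult_lt_0_compat; [apply Rmult_lt_0_compat; [lra|exact H]|assumption]. }
  clearbody c B.
  set (s := Rmin 1 (Rmin (d / 4) (c / (2 * B)))).
  assert (Hs0 : (0 < s)%R).
  { repeat apply Rmin_pos; try lra. apply Rdiv_lt_0_compat; lra. }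
  assert (Hs1 : (s <= 1)%R) by apply Rmin_l.
  assert (Hs2 : (s <= d / 4)%R) by (eapply Rle_trans; [apply Rmin_r|apply Rmin_l]).
  assert (Hs3 : (s <= c / (2 * B))%R) by (eapply Rle_trans; [apply Rmin_r|apply Rmin_r]).
  specialize (Hest s ltac:(lra) ltac:(lra)).
  apply Rmult_le_compat_r with (r := B) in Hs3; [|lra].
  replace (c / (2 * B) * B)%R with (c / 2)%R in Hs3 by (field; lra). lra.
Qed.

(** * Analytic functions on the disk *)

Lemma analytic_intro (f : C -> C) :
  (forall z, in_disk z -> exists l, is_cderive f z l) -> analytic_on_disk f.
Proof. intros H z Hz. exact (H z Hz). Qed.

Lemma analytic_const (c : C) : analytic_on_disk (fun _ => c).
Proof. apply analytic_intro. intros z _. exists 0. apply is_cderive_const. Qed.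

Lemma analytic_id : analytic_on_disk (fun z => z).
Proof. apply analytic_intro. intros z _. exists 1. apply is_cderive_id. Qed.

Lemma analytic_plus (f g : C -> C) :
  analytic_on_disk f -> analytic_on_disk g -> analytic_on_disk (fun z => f z + g z).
Proof.
  intros Hf Hg. apply analytic_intro. intros z Hz.
  destruct (analytic_cderive f z Hf Hz) as [l Hl], (analytic_cderive g z Hg Hz) as [m Hm].
  exists (l + m). apply is_cderive_plus; assumption.
Qed.

Lemma analytic_mult (f g : C -> C) :
  analytic_on_disk f -> analytic_on_disk g -> analytic_on_disk (fun z => f z * g z).
Proof.
  intros Hf Hg. apply analytic_intro. intros z Hz.
  destruct (analytic_cderive f z Hf Hz) as [l Hl], (analytic_cderive g z Hg Hz) as [m Hm].
  exists (l * g z + f z * m). apply is_cderive_mult; assumption.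
Qed.

Lemma analytic_cexp (f : C -> C) :
  analytic_on_disk f -> analytic_on_disk (fun z => cexp (f z)).
Proof.
  intros Hf. apply analytic_intro. intros z Hz.
  destruct (analytic_cderive f z Hf Hz) as [l Hl]. exists (l * cexp (f z)).
  apply (is_cderive_comp cexp f); [apply is_cderive_cexp|exact Hl].
Qed.

Lemma analytic_pow (f : C -> C) (n : nat) :
  analytic_on_disk f -> analytic_on_disk (fun z => f z ^ n).
Proof.
  intros Hf. induction n as [|n IH]; simpl.
  - apply analytic_const.
  - apply analytic_mult; assumption.
Qed.

(** * Maximum principles *)

Lemma le_of_pow_le (x y K : R) : (0 <= x)%R -> (0 <= y)%R ->
  (forall n, x ^ n <= K * y ^ n)%R -> (x <= y)%R.
Proof.
  intros Hx Hy H. apply Rnot_lt_le. intros Hlt.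
  destruct (Rle_lt_or_eq_dec 0 y Hy) as [Hy0|<-].
  - destruct (Pow_x_infinity (x / y)%R) with (b := (K + 1)%R) as [n Hn].
    { rewrite Rabs_pos_eq; [|apply Rlt_le, Rdiv_lt_0_compat; lra].
      apply (Rmult_lt_reg_r y); [exact Hy0|].
      replace (x / y * y)%R with x by (field; lra). lra. }
    specialize (Hn n (le_n n)). specialize (H n).
    assert (Hyn : (0 < y ^ n)%R) by (apply pow_lt; exact Hy0).
    rewrite Rabs_pos_eq in Hn.
    2: { apply pow_le, Rlt_le, Rdiv_lt_0_compat; lra. }
    unfold Rdiv in Hn. rewrite Rpow_mult_distr, pow_inv in Hn.
    apply Rge_le, (Rmult_le_compat_r (y ^ n)) in Hn; [|lra].
    rewrite Rmult_assoc, Rinv_l, Rmult_1_r in Hn by lra. lra.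
  - specialize (H 1%nat). simpl in H. lra.
Qed.

(** Landau's trick: Cauchy's formula for f^n gives |f z|^n <= K M^n with K
    independent of n, and the n-th root removes K. *)
Lemma max_modulus (f : C -> C) (r M : R) (z : C) : analytic_on_disk f ->
  (Cmod z < r < 1)%R -> (0 <= M)%R ->
  (forall w, Cmod w = r -> (Cmod (f w) <= M)%R) -> (Cmod (f z) <= M)%R.
Proof.
  intros Hf Hz HM H.
  assert (Hr : (0 <= r)%R) by (generalize (Cmod_ge_0 z); lra).
  assert (Hk : continuous_curve (cauchy_kernel r z) 0 (2 * PI))
    by (apply continuous_cauchy_kernel; lra).
  destruct (continuous_curve_bounded _ 0 (2 * PI) two_PI_pos Hk) as [K [HK0 HK]].
  apply (le_of_pow_le _ _ K); [apply Cmod_ge_0|exact HM|].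
  intros n. rewrite <- Cmod_pow.
  assert (HP := PI_RGT_0).
  apply (Rmult_le_reg_l (2 * PI)); [lra|].
  rewrite <- (Rabs_pos_eq (2 * PI)) at 1 by lra.
  rewrite <- Cmod_R, <- Cmod_mult.
  rewrite <- (cauchy_formula (fun z => f z ^ n) r z (analytic_pow f n Hf) Hz).
  eapply Rle_trans; [apply CInt_bound with (M := (K * M ^ n)%R)|].
  - apply two_PI_pos.
  - apply continuous_curve_mult; [|exact Hk].
    apply (continuous_on_circle (fun z => f z ^ n)); [apply analytic_pow; exact Hf|lra].
  - intros t Ht. rewrite Cmod_mult, Cmod_pow, Rmult_comm.
    apply Rmult_le_compat; try apply Cmod_ge_0; [apply pow_le, Cmod_ge_0|apply HK; exact Ht|].
    apply pow_incr. split; [apply Cmod_ge_0|]. apply H. apply Cmod_circle; exact Hr.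
  - right. ring.
Qed.

(** |exp f| = exp (Re f), so this is the maximum modulus principle for exp f. *)
Lemma max_real_part (f : C -> C) (r m : R) (z : C) : analytic_on_disk f ->
  (Cmod z < r < 1)%R ->
  (forall w, Cmod w = r -> (Re (f w) <= m)%R) -> (Re (f z) <= m)%R.
Proof.
  intros Hf Hz H. apply Rnot_lt_le. intros Hlt. apply exp_increasing in Hlt.
  revert Hlt. apply Rle_not_lt. rewrite <- Cmod_cexp.
  apply (max_modulus (fun z => cexp (f z)) r); [apply analytic_cexp; exact Hf|exact Hz| |].
  - apply Rlt_le, exp_pos.
  - intros w Hw. rewrite Cmod_cexp. destruct (H w Hw) as [Hw'|Hw']; [|rewrite Hw'; lra].
    apply Rlt_le, exp_increasing. exact Hw'.
Qed.

(** * Division by z and Schwarz's lemma *)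

Lemma C2PI_neq_0 : RtoC (2 * PI) <> 0.
Proof. intros E. apply RtoC_inj in E. generalize PI_RGT_0. lra. Qed.

(** The quotient f(z) / z is differentiable at 0 because near 0 it is the
    integral U of f(zeta) / (zeta - z) over a circle: subtracting Cauchy's
    formulas at z and at 0 gives f z - f 0 = z U z, and U is differentiable
    under the integral sign, as the kernel is explicit. *)
Lemma factor_zero (f : C -> C) : analytic_on_disk f -> f 0 = 0 ->
  exists u, analytic_on_disk u /\ forall z, f z = z * u z.
Proof.
  intros Hf H0.
  set (w := circle (1 / 2)).
  assert (Hw : forall t, Cmod (w t) = (1 / 2)%R) by (intros t; apply Cmod_circle; lra).
  assert (Hw0 : forall t, w t <> 0) by (intros t; apply circle_neq_0; lra).
  assert (Hwz : forall z t, (Cmod z < 1 / 2)%R -> w t - z <> 0)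
    by (intros z t; apply circle_minus_neq_0).
  assert (Hcw : continuous_curve w 0 (2 * PI)) by apply continuous_curve_circle.
  assert (Hcf : continuous_curve (fun t => f (w t)) 0 (2 * PI))
    by (apply continuous_on_circle; [exact Hf|lra]).
  assert (Hci : forall z, (Cmod z < 1 / 2)%R ->
    continuous_curve (fun t => / (w t - z)) 0 (2 * PI)).
  { intros z Hz. apply (continuous_curve_inv (fun t => w t - z)).
    - intros t _. apply Hwz; exact Hz.
    - apply continuous_curve_minus_const. exact Hcw. }
  set (I z := CInt (fun t => f (w t) * / (w t - z)) 0 (2 * PI)).
  set (U z := / RtoC (2 * PI) * I z).
  assert (HU : forall z, (Cmod z < 1 / 2)%R -> f z = z * U z).
  { intros z Hz.
    assert (E : RtoC (2 * PI) * f z - RtoC (2 * PI) * f 0 = z * I z).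
    { rewrite <- (cauchy_formula f (1 / 2) z Hf) by lra.
      rewrite <- (cauchy_formula f (1 / 2) 0 Hf) by (rewrite Cmod_0; lra).
      unfold I. rewrite <- CInt_scal, <- CInt_minus; try apply two_PI_pos.
      - apply CInt_ext; [apply two_PI_pos|]. intros t _. unfold cauchy_kernel.
        fold (w t). field.
        repeat split; first [apply Hw0|apply Hwz; rewrite ?Cmod_0; lra].
      - apply continuous_curve_mult; [exact Hcf|apply continuous_cauchy_kernel; exact Hz].
      - apply continuous_curve_mult; [exact Hcf|].
        apply continuous_cauchy_kernel; rewrite Cmod_0; lra.
      - apply continuous_curve_mult; [exact Hcf|apply Hci; exact Hz]. }
    rewrite H0, Cmult_0_r in E. unfold U.
    replace (z * (/ RtoC (2 * PI) * I z)) with (/ RtoC (2 * PI) * (z * I z)) by ring.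
    rewrite <- E. field. apply C2PI_neq_0. }
  destruct (continuous_curve_bounded _ 0 (2 * PI) two_PI_pos Hcf) as [M [HM0 HM]].
  assert (HU0 : exists l, is_cderive U 0 l).
  { exists (/ RtoC (2 * PI) * CInt (fun t => f (w t) * / (w t * w t)) 0 (2 * PI)).
    apply is_cderive_eps. intros eps Heps.
    (* For |y| < 1/4 the remainder kernel is at most 16 |y|^2. *)
    exists (Rmin (1 / 4) (eps / (16 * M))). split.
    { apply Rmin_pos; [lra|]. apply Rdiv_lt_0_compat; lra. }
    intros y Hy. destruct (Rmin_Rgt_l _ _ _ Hy) as [Hy1 Hy2].
    replace (y - 0) with y in * by ring.
    assert (C0 : continuous_curve (fun t => f (w t) * / (w t - 0)) 0 (2 * PI)).
    { apply continuous_curve_mult; [exact Hcf|apply Hci]. rewrite Cmod_0. lra. }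
    assert (Cy : continuous_curve (fun t => f (w t) * / (w t - y)) 0 (2 * PI)).
    { apply continuous_curve_mult; [exact Hcf|apply Hci]. lra. }
    assert (C2 : continuous_curve (fun t => f (w t) * / (w t * w t)) 0 (2 * PI)).
    { apply continuous_curve_mult; [exact Hcf|].
      apply (continuous_curve_inv (fun t => w t * w t)).
      - intros t _. apply Cmult_neq_0; apply Hw0.
      - apply continuous_curve_mult; exact Hcw. }
    assert (C2y : continuous_curve (fun t => y * (f (w t) * / (w t * w t))) 0 (2 * PI)).
    { apply continuous_curve_mult; [apply continuous_curve_const|exact C2]. }
    assert (Cm : continuous_curve (fun t => f (w t) * / (w t - y) - f (w t) * / (w t - 0)) 0 (2 * PI)).
    { intros t Ht. exact (continuous_minus (V:=C_R_NormedModule) _ _ t (Cy t Ht) (C0 t Ht)). }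
    set (I2 := CInt (fun t => f (w t) * / (w t * w t)) 0 (2 * PI)).
    replace (U y - U 0 - y * (/ RtoC (2 * PI) * I2))
      with (/ RtoC (2 * PI) * (I y - I 0 - y * I2)) by (unfold U; ring).
    unfold I, I2.
    rewrite <- CInt_scal; [|apply two_PI_pos|exact C2].
    rewrite <- CInt_minus; [|apply two_PI_pos|exact Cy|exact C0].
    rewrite <- CInt_minus; [|apply two_PI_pos|exact Cm|exact C2y].
    rewrite Cmod_mult, Cmod_inv, Cmod_R, Rabs_pos_eq by (apply C2PI_neq_0 || apply two_PI_pos).
    assert (HP := PI_RGT_0).
    apply (Rmult_le_reg_l (2 * PI)); [lra|].
    rewrite <- Rmult_assoc, Rinv_r, Rmult_1_l by lra.
    eapply Rle_trans; [apply CInt_bound with (M := (eps * Cmod y)%R)|].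
    - apply two_PI_pos.
    - intros t Ht. exact (continuous_minus (V:=C_R_NormedModule) _ _ t (Cm t Ht) (C2y t Ht)).
    - intros t Ht.
      assert (Hwy : (1 / 4 <= Cmod (w t - y))%R).
      { generalize (Cmod_minus_ge (w t) y). rewrite Hw. lra. }
      (* 1/(w-y) - 1/w - y/w^2 = y^2/(w^2 (w-y)), with |w| = 1/2. *)
      replace (f (w t) * / (w t - y) - f (w t) * / (w t - 0) - y * (f (w t) * / (w t * w t)))
        with (f (w t) * (y * y) * / (w t * w t * (w t - y))).
      2: { field. repeat split; first [apply Hw0|apply Hwz; rewrite ?Cmod_0; lra]. }
      rewrite !Cmod_mult, Cmod_inv, !Cmod_mult, Hw.
      2: { apply Cmult_neq_0; [apply Cmult_neq_0; apply Hw0|apply Hwz; lra]. }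
      set (c := Cmod (w t - y)) in *.
      assert (Hinv : (/ (1 / 2 * (1 / 2) * c) <= 16)%R).
      { apply (Rmult_le_reg_l (1 / 2 * (1 / 2) * c)); [nra|]. rewrite Rinv_r by nra. lra. }
      assert (Hinv0 : (0 < / (1 / 2 * (1 / 2) * c))%R) by (apply Rinv_0_lt_compat; nra).
      specialize (HM t Ht). assert (Hf0 := Cmod_ge_0 (f (w t))). assert (Hy0 := Cmod_ge_0 y).
      apply Rle_trans with (M * (Cmod y * Cmod y) * 16)%R.
      { apply Rmult_le_compat; try nra. }
      apply Rlt_le, (Rmult_le_compat_r (16 * M)) in Hy2; [|lra].
      replace (eps / (16 * M) * (16 * M))%R with eps in Hy2 by (field; lra).
      replace (M * (Cmod y * Cmod y) * 16)%R with (Cmod y * (16 * M) * Cmod y)%R by ring.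
      apply Rmult_le_compat_r; lra.
    - right. ring. }
  set (u z := if Ceq_dec z 0 then U 0 else f z / z).
  assert (Hu : forall z, f z = z * u z).
  { intros z. unfold u. destruct (Ceq_dec z 0) as [->|Hz].
    - rewrite H0. ring.
    - field. exact Hz. }
  exists u. split; [|exact Hu].
  apply analytic_intro. intros z Hz. destruct (Ceq_dec z 0) as [->|Hz0].
  - destruct HU0 as [l Hl]. exists l.
    apply (is_cderive_ext_loc U u 0 l (1 / 2)); [lra| |exact Hl].
    intros y Hy. replace (y - 0) with y in Hy by ring. unfold u.
    destruct (Ceq_dec y 0) as [->|Hy0]; [reflexivity|].
    rewrite (HU y Hy). field. exact Hy0.
  - destruct (analytic_cderive f z Hf Hz) as [l Hl].
    eexists. apply (is_cderive_ext_loc (fun y => f y * / y) u z _ (Cmod z)).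
    + apply Cmod_gt_0; exact Hz0.
    + intros y Hy. unfold u. destruct (Ceq_dec y 0) as [->|_]; [exfalso|reflexivity].
      rewrite Cmod_minus_sym in Hy. replace (z - 0) with z in Hy by ring. lra.
    + apply is_cderive_mult; [exact Hl|apply is_cderive_inv; exact Hz0].
Qed.

(** On |z| = r the quotient u = w / z is bounded by 1 / r. If |u z| = m > 1,
    a radius r between 1 / m and 1 contradicts the maximum principle. *)
Lemma schwarz_lemma (w : C -> C) (z : C) : schwarz_function w -> in_disk z ->
  (Cmod (w z) <= Cmod z)%R.
Proof.
  intros [Hw [Hw0 Hw1]] Hz. destruct (factor_zero w Hw Hw0) as [u [Hu E]].
  assert (H : (Cmod (u z) <= 1)%R).
  { apply Rnot_lt_le. intros Hlt. unfold in_disk in Hz.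
    assert (Hz0 := Cmod_ge_0 z).
    set (m := Cmod (u z)) in *.
    assert (Hm : (0 < / m < 1)%R).
    { split; [apply Rinv_0_lt_compat; lra|]. rewrite <- Rinv_1. apply Rinv_lt_contravar; lra. }
    set (r := ((1 + Rmax (Cmod z) (/ m)) / 2)%R).
    assert (R1 := Rmax_l (Cmod z) (/ m)). assert (R2 := Rmax_r (Cmod z) (/ m)).
    assert (R3 : (Rmax (Cmod z) (/ m) < 1)%R) by (apply Rmax_lub_lt; lra).
    assert (Hr : (Cmod z < r < 1)%R) by (unfold r; lra).
    assert (Hrm : (/ m < r)%R) by (unfold r; lra).
    assert (Hu1 : (m <= / r)%R).
    { apply (max_modulus u r); [exact Hu|exact Hr|apply Rlt_le, Rinv_0_lt_compat; lra|].
      intros v Hv. assert (Hv1 : (Cmod (w v) < 1)%R) by (apply Hw1; unfold in_disk; lra).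
      rewrite E, Cmod_mult, Hv in Hv1.
      apply (Rmult_le_reg_l r); [lra|]. rewrite Rinv_r by lra. lra. }
    assert (Hc : (/ r < / / m)%R) by (apply Rinv_lt_contravar; [apply Rmult_lt_0_compat; lra|exact Hrm]).
    rewrite Rinv_inv in Hc. lra. }
  rewrite E, Cmod_mult. generalize (Cmod_ge_0 z). nra.
Qed.

(** * Primitives *)

(** Integrate f along the segment from 0 to z. The homotopy between the segments
    to z and to y leaves the integral along the segment from z to y as the
    increment, and there f is close to the constant f z. *)
Lemma primitive_exists (f : C -> C) : analytic_on_disk f ->
  exists U : C -> C, U 0 = 0 /\ forall z, in_disk z -> is_cderive U z (f z).
Proof.
  intros Hf.
  set (U z := path_integral f (fun s => 0 + RtoC s * z) (fun _ => z) 0 1).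
  exists U. split.
  { unfold U, path_integral. rewrite (CInt_ext _ (fun _ => 0)); [|lra|].
    - rewrite CInt_const. ring.
    - intros t _. ring. }
  intros z Hz. unfold in_disk in Hz.
  assert (Hseg : forall y, in_disk y -> forall s t, (0 <= s <= 1)%R -> (0 <= t <= 1)%R ->
    in_disk (0 + RtoC s * (z + RtoC t * (y - z)))).
  { intros y Hy s t Hs Ht. unfold in_disk in *.
    replace (0 + RtoC s * (z + RtoC t * (y - z)))
      with (RtoC s * (RtoC (1 - t) * z + RtoC t * y)) by (rewrite RtoC_minus; ring).
    rewrite Cmod_mult, Cmod_R, Rabs_pos_eq by lra.
    assert (H : (Cmod (RtoC (1 - t) * z + RtoC t * y) < 1)%R).
    { eapply Rle_lt_trans; [apply Cmod_triangle|].
      rewrite !Cmod_mult, !Cmod_R, !Rabs_pos_eq by lra.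
      destruct (Req_dec t 0) as [->|Ht0]; [lra|].
      apply Rle_lt_trans with ((1 - t) * 1 + t * Cmod y)%R.
      - apply Rplus_le_compat_r, Rmult_le_compat_l; lra.
      - apply Rlt_le_trans with ((1 - t) * 1 + t * 1)%R; [|lra].
        apply Rplus_lt_compat_l, Rmult_lt_compat_l; lra. }
    generalize (Cmod_ge_0 (RtoC (1 - t) * z + RtoC t * y)). nra. }
  assert (Hinc : forall y, in_disk y ->
    U y - U z = path_integral f (fun t => z + RtoC t * (y - z)) (fun _ => y - z) 0 1).
  { intros y Hy.
    assert (H := line_homotopy f (fun _ => 0) (fun _ => 0) (fun t => z + RtoC t * (y - z))
      (fun _ => y - z) 0 1 0 1 ltac:(lra) ltac:(lra)
      (fun t _ => is_curve_derive_const 0 t)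
      (fun t _ => is_curve_derive_affine z (y - z) t)
      (continuous_curve_const _ _ _) (continuous_curve_const _ _ _)
      (fun s t Hs Ht => analytic_cderive f _ Hf (Hseg y Hy s t Hs Ht))).
    cbv zeta beta in H. unfold U.
    unfold path_integral in *.
    replace (z + 0 * (y - z)) with z in H by ring.
    replace (z + 1 * (y - z)) with y in H by ring.
    rewrite (CInt_ext (fun t => f (0 + 0 * (z + RtoC t * (y - z))) * (0 + 0 * (y - z)))
      (fun _ => 0)) in H; [|lra|intros; ring].
    rewrite CInt_const in H.
    rewrite (CInt_ext (fun t => f (0 + 1 * (z + RtoC t * (y - z))) * (0 + 1 * (y - z)))
      (fun t => f (z + RtoC t * (y - z)) * (y - z))) in H; [|lra|].
    2: { intros t _. f_equal; [f_equal|]; ring. }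
    match type of H with (?a + ?b = ?c + _) =>
      replace b with (a + b - a) by ring; rewrite H; ring end. }
  apply is_cderive_eps. intros eps Heps.
  destruct (analytic_cderive f z Hf Hz) as [l Hl].
  destruct (is_cderive_lipschitz f z l Hl) as [L [d [HL [Hd Hd']]]].
  exists (Rmin (1 - Cmod z) (Rmin d (eps / L))). split.
  { repeat apply Rmin_pos; try lra. apply Rdiv_lt_0_compat; lra. }
  intros y Hy. destruct (Rmin_Rgt_l _ _ _ Hy) as [Hy1 Hy'].
  destruct (Rmin_Rgt_l _ _ _ Hy') as [Hy2 Hy3].
  assert (Hyd : in_disk y).
  { unfold in_disk. generalize (Cmod_minus_ge y z). lra. }
  rewrite (Hinc y Hyd).
  replace ((y - z) * f z) with
    (affine_primitive (f z) 0 (z + RtoC 1 * (y - z)) - affine_primitive (f z) 0 (z + RtoC 0 * (y - z)))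
    by (unfold affine_primitive; ring).
  eapply Rle_trans.
  - apply (path_integral_affine_approx f (fun t => z + RtoC t * (y - z)) (fun _ => y - z)
      0 1 (Cmod (y - z)) eps (f z) 0).
    + lra.
    + intros t _. apply is_curve_derive_affine.
    + apply continuous_curve_const.
    + intros t _. lra.
    + apply continuous_curve_comp.
      * intros t Ht. apply analytic_cderive; [exact Hf|].
        generalize (Hseg y Hyd 1%R t ltac:(lra) Ht).
        replace (0 + RtoC 1 * (z + RtoC t * (y - z))) with (z + RtoC t * (y - z)) by ring.
        trivial.
      * apply (continuous_curve_derive _ (fun _ => y - z)).
        intros t _. apply is_curve_derive_affine.
    + intros t Ht.
      replace (f (z + RtoC t * (y - z)) - (f z + 0 * (z + RtoC t * (y - z))))
        with (f (z + RtoC t * (y - z)) - f z) by ring.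
      assert (Hle : (Cmod (z + RtoC t * (y - z) - z) <= Cmod (y - z))%R).
      { replace (z + RtoC t * (y - z) - z) with (RtoC t * (y - z)) by ring.
        rewrite Cmod_mult, Cmod_R, Rabs_pos_eq by lra.
        generalize (Cmod_ge_0 (y - z)). nra. }
      eapply Rle_trans; [apply Hd'; lra|].
      apply Rgt_lt, (Rmult_lt_compat_l L) in Hy3; [|lra].
      replace (L * (eps / L))%R with eps in Hy3 by (field; lra).
      apply Rle_trans with (L * Cmod (y - z))%R; [apply Rmult_le_compat_l|]; lra.
  - rewrite Rminus_0_r. lra.
Qed.

(** * Taylor expansion *)

Fixpoint partial_sum (a : nat -> C) (z : C) (n : nat) : C :=
  match n with
  | O => a O
  | S m => partial_sum a z m + z ^ S m * a (S m)
  end.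

Lemma pow_n_Cpow (z : C) (n : nat) : @pow_n C_AbsRing z n = z ^ n.
Proof. induction n as [|n IH]; [reflexivity|]. simpl. rewrite IH. reflexivity. Qed.

Lemma sum_n_partial_sum (a : nat -> C) (z : C) (n : nat) :
  @sum_n C_NormedModule (fun k => @scal C_AbsRing C_NormedModule (@pow_n C_AbsRing z k) (a k)) n
  = partial_sum a z n.
Proof.
  induction n as [|n IH].
  - rewrite sum_O. apply Cmult_1_l.
  - rewrite sum_Sn, IH. rewrite pow_n_Cpow. reflexivity.
Qed.

Lemma is_pseries_eps (a : nat -> C) (z l : C) :
  @is_pseries C_AbsRing C_NormedModule a z l <->
  forall eps : R, (0 < eps)%R -> exists N : nat, forall n, (N <= n)%nat ->
    (Cmod (partial_sum a z n - l) < eps)%R.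
Proof.
  split.
  - intros H eps Heps.
    assert (H' := proj1 (filterlim_locally_ball_norm (K:=C_AbsRing) (U:=C_NormedModule) _ _) H (mkposreal eps Heps)).
    destruct H' as [N HN]. exists N. intros n Hn.
    rewrite <- sum_n_partial_sum. exact (HN n Hn).
  - intros H. apply (filterlim_locally_ball_norm (K:=C_AbsRing) (U:=C_NormedModule)).
    intros eps. destruct (H eps (cond_pos eps)) as [N HN]. exists N. intros n Hn.
    generalize (HN n Hn). rewrite <- sum_n_partial_sum. trivial.
Qed.

Definition cauchy_coefficient (f : C -> C) (r : R) (k : nat) : C :=
  / RtoC (2 * PI) * CInt (fun t => f (circle r t) * / circle r t ^ k) 0 (2 * PI).

Lemma is_cderive_pow (n : nat) (z : C) : exists l, is_cderive (fun y => y ^ n) z l.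
Proof.
  induction n as [|n [l Hl]]; simpl.
  - exists 0. apply is_cderive_const.
  - eexists. apply is_cderive_mult; [apply is_cderive_id|exact Hl].
Qed.

Lemma continuous_cauchy_coefficient (f : C -> C) (r : R) (k : nat) :
  analytic_on_disk f -> (0 < r < 1)%R ->
  continuous_curve (fun t => f (circle r t) * / circle r t ^ k) 0 (2 * PI).
Proof.
  intros Hf Hr. apply continuous_curve_mult; [apply continuous_on_circle; [exact Hf|lra]|].
  apply (continuous_curve_inv (fun t => circle r t ^ k)).
  - intros t _. apply Cpow_nz, circle_neq_0. lra.
  - apply (continuous_curve_comp (fun w => w ^ k)); [|apply continuous_curve_circle].
    intros t _. apply is_cderive_pow.
Qed.

(** This lets circles of radius arbitrarily close to 1 give one and the same
    power series: the function f(zeta) / zeta^(k+1) is analytic between two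
    circles around 0. *)
Lemma cauchy_coefficient_indep (f : C -> C) (r r' : R) (k : nat) :
  analytic_on_disk f -> (0 < r <= r')%R -> (r' < 1)%R ->
  cauchy_coefficient f r' k = cauchy_coefficient f r k.
Proof.
  intros Hf Hr Hr'. unfold cauchy_coefficient. f_equal.
  assert (Hw : forall s, (0 < s < 1)%R ->
    path_integral (fun w => f w * / w ^ S k) (fun t => 0 + RtoC s * circle 1 t)
      (fun t => 0 + RtoC s * (Ci * circle 1 t)) 0 (2 * PI)
    = Ci * CInt (fun t => f (circle s t) * / circle s t ^ k) 0 (2 * PI)).
  { intros s Hs.
    rewrite <- CInt_scal; [|apply two_PI_pos|apply continuous_cauchy_coefficient; assumption].
    apply CInt_ext; [apply two_PI_pos|]. intros t _.
    replace (0 + RtoC s * circle 1 t) with (circle s t) by (rewrite (circle_scal s t); ring).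
    replace (0 + RtoC s * (Ci * circle 1 t)) with (Ci * circle s t) by (rewrite (circle_scal s t); ring).
    rewrite Cpow_S. field. split; [apply Cpow_nz|]; apply circle_neq_0; lra. }
  assert (H : Ci * CInt (fun t => f (circle r' t) * / circle r' t ^ k) 0 (2 * PI)
    = Ci * CInt (fun t => f (circle r t) * / circle r t ^ k) 0 (2 * PI)).
  { rewrite <- !Hw by lra.
    apply (closed_line_homotopy (fun w => f w * / w ^ S k) (fun _ => 0) (fun _ => 0)
      (circle 1) (fun t => Ci * circle 1 t)).
    - apply two_PI_pos.
    - lra.
    - intros t _. apply is_curve_derive_const.
    - intros t _. apply is_curve_derive_circle.
    - apply continuous_curve_const.
    - apply continuous_curve_mult; [apply continuous_curve_const|apply continuous_curve_circle].
    - reflexivity.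
    - apply circle_closed.
    - intros s t Hs _.
      replace (0 + RtoC s * circle 1 t) with (circle s t) by (rewrite (circle_scal s t); ring).
      destruct (analytic_cderive f (circle s t) Hf) as [l Hl].
      { unfold in_disk. rewrite Cmod_circle; lra. }
      destruct (is_cderive_pow (S k) (circle s t)) as [m Hm].
      eexists. apply is_cderive_mult; [exact Hl|].
      apply (is_cderive_comp Cinv (fun w => w ^ S k)); [|exact Hm].
      apply is_cderive_inv. apply Cpow_nz, circle_neq_0. lra. }
  exact (Cmult_Ci_inj _ _ H).
Qed.

(** The finite geometric expansion of the kernel in powers of z / zeta,
    integrated against f: one step uses kernel (1 - z / zeta) = 1. *)
Lemma cauchy_remainder (f : C -> C) (r : R) (z : C) (n : nat) :
  analytic_on_disk f -> (Cmod z < r < 1)%R ->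
  RtoC (2 * PI) * (f z - partial_sum (cauchy_coefficient f r) z n) =
  CInt (fun t => f (circle r t) * cauchy_kernel r z t * (z * / circle r t) ^ S n) 0 (2 * PI).
Proof.
  intros Hf Hz. assert (Hr : (0 < r < 1)%R) by (generalize (Cmod_ge_0 z); lra).
  assert (HcK : continuous_curve (fun t => f (circle r t) * cauchy_kernel r z t) 0 (2 * PI)).
  { apply continuous_curve_mult; [apply continuous_on_circle; [exact Hf|lra]|].
    apply continuous_cauchy_kernel. lra. }
  assert (Hcp : forall m, continuous_curve (fun t => (z * / circle r t) ^ m) 0 (2 * PI)).
  { intros m. apply (continuous_curve_comp (fun w => w ^ m)).
    - intros t _. apply is_cderive_pow.
    - apply continuous_curve_mult; [apply continuous_curve_const|].
      apply continuous_curve_inv; [|apply continuous_curve_circle].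
      intros t _. apply circle_neq_0. lra. }
  assert (Hc := fun k => continuous_cauchy_coefficient f r k Hf Hr).
  assert (Hstep : forall k,
    CInt (fun t => f (circle r t) * cauchy_kernel r z t * (z * / circle r t) ^ S k) 0 (2 * PI) =
    CInt (fun t => f (circle r t) * cauchy_kernel r z t * (z * / circle r t) ^ k) 0 (2 * PI)
    - RtoC (2 * PI) * (z ^ k * cauchy_coefficient f r k)).
  { intros k. unfold cauchy_coefficient.
    match goal with |- _ = _ - _ * (_ * (_ * ?c)) =>
      replace (RtoC (2 * PI) * (z ^ k * (/ RtoC (2 * PI) * c))) with (z ^ k * c)
        by (field; apply C2PI_neq_0) end.
    rewrite <- CInt_scal, <- CInt_minus; try apply two_PI_pos; try apply Hc.
    - apply CInt_ext; [apply two_PI_pos|]. intros t _. unfold cauchy_kernel.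
      rewrite Cpow_S, Cpow_mult_l, Cpow_inv by (apply circle_neq_0; lra).
      field. repeat split;
        first [apply Cpow_nz, circle_neq_0; lra|apply circle_minus_neq_0; lra|apply circle_neq_0; lra].
    - apply continuous_curve_mult; [exact HcK|apply Hcp].
    - apply continuous_curve_mult; [apply continuous_curve_const|apply Hc]. }
  induction n as [|n IH].
  - rewrite Hstep. simpl partial_sum.
    rewrite (CInt_ext (fun t => f (circle r t) * cauchy_kernel r z t * (z * / circle r t) ^ 0)
      (fun t => f (circle r t) * cauchy_kernel r z t)); [|apply two_PI_pos|intros; simpl; ring].
    rewrite cauchy_formula by assumption. simpl. ring.
  - rewrite Hstep, <- IH. simpl partial_sum. simpl Cpow. ring.
Qed.

(** The coefficients are computed on the circle of radius 1/2; at a given z the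
    remainder is estimated on a circle of radius r > |z|. *)
Theorem taylor_expansion (f : C -> C) : analytic_on_disk f ->
  exists a, forall z, in_disk z -> @is_pseries C_AbsRing C_NormedModule a z (f z).
Proof.
  intros Hf. exists (cauchy_coefficient f (1 / 2)). intros z Hz. unfold in_disk in Hz.
  set (r := ((1 + Rmax (Cmod z) (1 / 2)) / 2)%R).
  assert (R1 := Rmax_l (Cmod z) (1 / 2)). assert (R2 := Rmax_r (Cmod z) (1 / 2)).
  assert (R3 : (Rmax (Cmod z) (1 / 2) < 1)%R) by (apply Rmax_lub_lt; lra).
  assert (Hr : (Cmod z < r < 1)%R) by (unfold r; lra).
  assert (Hr2 : (1 / 2 <= r)%R) by (unfold r; lra).
  assert (Hz0 := Cmod_ge_0 z).
  assert (HcK : continuous_curve (fun t => f (circle r t) * cauchy_kernel r z t) 0 (2 * PI)).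
  { apply continuous_curve_mult; [apply continuous_on_circle; [exact Hf|lra]|].
    apply continuous_cauchy_kernel. lra. }
  destruct (continuous_curve_bounded _ 0 (2 * PI) two_PI_pos HcK) as [M [HM0 HM]].
  set (q := (Cmod z / r)%R).
  assert (Hq : (0 <= q < 1)%R).
  { unfold q. split.
    - apply Rmult_le_pos; [exact Hz0|apply Rlt_le, Rinv_0_lt_compat; lra].
    - apply (Rmult_lt_reg_r r); [lra|]. replace (Cmod z / r * r)%R with (Cmod z) by (field; lra). lra. }
  assert (Hrem : forall n, (Cmod (partial_sum (cauchy_coefficient f (1 / 2)) z n - f z) <= M * q ^ S n)%R).
  { intros n. assert (HP := PI_RGT_0).
    replace (partial_sum (cauchy_coefficient f (1 / 2)) z n) with (partial_sum (cauchy_coefficient f r) z n).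
    2: { induction n as [|n IH]; simpl; [|rewrite IH];
         rewrite (cauchy_coefficient_indep f (1 / 2) r) by (exact Hf || lra); reflexivity. }
    rewrite Cmod_minus_sym. apply (Rmult_le_reg_l (2 * PI)); [lra|].
    rewrite <- (Rabs_pos_eq (2 * PI)) at 1 by lra.
    rewrite <- Cmod_R, <- Cmod_mult, cauchy_remainder by assumption.
    eapply Rle_trans; [apply CInt_bound with (M := (M * q ^ S n)%R)|].
    - apply two_PI_pos.
    - apply continuous_curve_mult; [exact HcK|].
      apply (continuous_curve_comp (fun w => w ^ S n)); [intros t _; apply is_cderive_pow|].
      apply continuous_curve_mult; [apply continuous_curve_const|].
      apply continuous_curve_inv; [|apply continuous_curve_circle].
      intros t _. apply circle_neq_0. lra.
    - intros t Ht. rewrite Cmod_mult, Cmod_pow, (Cmod_mult z), Cmod_inv by (apply circle_neq_0; lra).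
      rewrite Cmod_circle by lra. fold (Rdiv (Cmod z) r). fold q.
      apply Rmult_le_compat_r; [apply pow_le; lra|apply HM; exact Ht].
    - right. ring. }
  apply is_pseries_eps. intros eps Heps.
  destruct (pow_lt_1_zero q ltac:(rewrite Rabs_pos_eq; lra) (eps / M)%R) as [N HN].
  { apply Rdiv_lt_0_compat; lra. }
  exists N. intros n Hn. eapply Rle_lt_trans; [apply Hrem|].
  specialize (HN (S n) ltac:(lia)). rewrite Rabs_pos_eq in HN by (apply pow_le; lra).
  apply (Rmult_lt_compat_l M) in HN; [|lra].
  replace (M * (eps / M))%R with eps in HN by (field; lra). exact HN.
Qed.

(** The coefficients of a series converging at 1/2 are at most M 2^n, so for
    |z| <= 1/4 the terms of degree at least 2 sum up to O(|z|^2). *)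
Lemma pseries_head (a : nat -> C) (f : C -> C) :
  (forall z, in_disk z -> @is_pseries C_AbsRing C_NormedModule a z (f z)) ->
  f 0 = a 0%nat /\ is_cderive f 0 (a 1%nat).
Proof.
  intros H.
  assert (H' : forall z, in_disk z -> forall eps : R, (0 < eps)%R -> exists N : nat,
    forall n, (N <= n)%nat -> (Cmod (partial_sum a z n - f z) < eps)%R).
  { intros z Hz. apply is_pseries_eps. exact (H z Hz). }
  assert (H0 : f 0 = a 0%nat).
  { assert (Hs : forall n, partial_sum a 0 n = a 0%nat).
    { induction n as [|n IH]; simpl; [reflexivity|]. rewrite IH. ring. }
    symmetry. apply Ceq_minus, Cmod_eq_0.
    apply Rle_antisym; [|apply Cmod_ge_0]. apply Rnot_lt_le. intros Hlt.
    destruct (H' 0 ltac:(unfold in_disk; rewrite Cmod_0; lra) _ Hlt) as [N HN].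
    specialize (HN N (le_n N)). rewrite Hs in HN. lra. }
  split; [exact H0|].
  assert (Hterm : exists M, (0 < M)%R /\ forall n, (Cmod (a n) <= M * 2 ^ n)%R).
  { set (h := RtoC (1 / 2)).
    assert (Hh : Cmod h = (1 / 2)%R) by (unfold h; rewrite Cmod_R; apply Rabs_pos_eq; lra).
    destruct (H' h ltac:(unfold in_disk; lra) 1%R ltac:(lra)) as [N HN].
    assert (Hbig : forall n, (N <= n)%nat -> (Cmod (a (S n)) <= 2 * 2 ^ S n)%R).
    { intros n Hn. assert (A1 := HN n Hn). assert (A2 := HN (S n) ltac:(lia)).
      assert (A3 : (Cmod (h ^ S n * a (S n)) <= 2)%R).
      { replace (h ^ S n * a (S n)) with ((partial_sum a h (S n) - f h) - (partial_sum a h n - f h))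
          by (simpl; ring).
        eapply Rle_trans; [apply Cmod_triangle|]. rewrite Cmod_opp. lra. }
      rewrite Cmod_mult, Cmod_pow, Hh in A3.
      replace (Cmod (a (S n))) with (2 ^ S n * ((1 / 2) ^ S n * Cmod (a (S n))))%R.
      - rewrite (Rmult_comm 2). apply Rmult_le_compat_l; [apply pow_le; lra|exact A3].
      - rewrite <- Rmult_assoc, <- Rpow_mult_distr.
        replace (2 * (1 / 2))%R with 1%R by field. rewrite pow1. ring. }
    assert (Hsmall : forall N, exists M, (2 <= M)%R /\ forall n, (n <= N)%nat -> (Cmod (a n) <= M * 2 ^ n)%R).
    { induction N0 as [|m [M [HM0 HM]]].
      - exists (2 + Cmod (a 0%nat))%R. split; [generalize (Cmod_ge_0 (a 0%nat)); lra|].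
        intros n Hn. replace n with 0%nat by lia. simpl. lra.
      - exists (M + Cmod (a (S m)))%R. assert (G := Cmod_ge_0 (a (S m))). split; [lra|].
        intros n Hn. assert (P : (1 <= 2 ^ n)%R) by (apply pow_R1_Rle; lra).
        destruct (Nat.eq_dec n (S m)) as [->|Hne].
        + nra.
        + specialize (HM n ltac:(lia)). nra. }
    destruct (Hsmall N) as [M [HM0 HM]]. exists M. split; [lra|]. intros n.
    destruct (Nat.le_gt_cases n N) as [Hn|Hn]; [apply HM; exact Hn|].
    destruct n as [|n]; [lia|]. eapply Rle_trans; [apply Hbig; lia|].
    apply Rmult_le_compat_r; [apply pow_le; lra|exact HM0]. }
  destruct Hterm as [M [HM0 HM]].
  assert (Htail : forall z, (Cmod z <= 1 / 4)%R ->
    (Cmod (f z - f 0 - z * a 1%nat) <= 8 * M * (Cmod z * Cmod z))%R).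
  { intros z Hz. assert (Hz0 := Cmod_ge_0 z). rewrite H0.
    assert (Hp : forall n, (Cmod (partial_sum a z (S n) - a 0%nat - z * a 1%nat)
      <= M * (4 * (Cmod z * Cmod z)) * (2 - 2 * (1 / 2) ^ n))%R).
    { induction n as [|n IH].
      - replace (partial_sum a z 1 - a 0%nat - z * a 1%nat) with (RtoC 0) by (simpl; ring).
        rewrite Cmod_0. simpl. lra.
      - replace (partial_sum a z (S (S n)) - a 0%nat - z * a 1%nat) with
          ((partial_sum a z (S n) - a 0%nat - z * a 1%nat) + z ^ S (S n) * a (S (S n)))
          by (simpl; ring).
        eapply Rle_trans; [apply Cmod_triangle|].
        apply Rle_trans with (M * (4 * (Cmod z * Cmod z)) * (2 - 2 * (1 / 2) ^ n)
          + M * (4 * (Cmod z * Cmod z)) * (1 / 2) ^ n)%R.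
        2: { right. simpl. field. }
        apply Rplus_le_compat; [exact IH|].
        rewrite Cmod_mult, Cmod_pow.
        apply Rle_trans with (Cmod z ^ S (S n) * (M * 2 ^ S (S n)))%R.
        { apply Rmult_le_compat_l; [apply pow_le; exact Hz0|apply HM]. }
        replace (Cmod z ^ S (S n) * (M * 2 ^ S (S n)))%R with
          (M * (4 * (Cmod z * Cmod z)) * (Cmod z * 2) ^ n)%R
          by (rewrite Rpow_mult_distr; simpl; ring).
        apply Rmult_le_compat_l; [nra|]. apply pow_incr. lra. }
    apply Rnot_lt_le. intros Hlt.
    destruct (H' z ltac:(unfold in_disk; lra) _ (proj1 (Rminus_lt_0 _ _) Hlt)) as [N HN].
    specialize (HN (S N) ltac:(lia)). specialize (Hp N).
    assert (P : (0 <= (1 / 2) ^ N)%R) by (apply pow_le; lra).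
    assert (Hq : (0 <= M * (4 * (Cmod z * Cmod z)))%R) by nra.
    assert (T : (Cmod (f z - a 0%nat - z * a 1%nat) <=
      Cmod (partial_sum a z (S N) - f z) + Cmod (partial_sum a z (S N) - a 0%nat - z * a 1%nat))%R).
    { replace (f z - a 0%nat - z * a 1%nat) with
       (- (partial_sum a z (S N) - f z) + (partial_sum a z (S N) - a 0%nat - z * a 1%nat)) by ring.
      eapply Rle_trans; [apply Cmod_triangle|]. rewrite Cmod_opp. lra. }
    nra. }
  apply is_cderive_eps. intros eps Heps.
  exists (Rmin (1 / 4) (eps / (8 * M))). split.
  { apply Rmin_pos; [lra|]. apply Rdiv_lt_0_compat; lra. }
  intros y Hy. destruct (Rmin_Rgt_l _ _ _ Hy) as [Hy1 Hy2].
  replace (y - 0) with y in * by ring.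
  eapply Rle_trans; [apply Htail; lra|].
  assert (Hy0 := Cmod_ge_0 y).
  apply Rgt_lt, (Rmult_lt_compat_l (8 * M)) in Hy2; [|lra].
  replace (8 * M * (eps / (8 * M)))%R with eps in Hy2 by (field; lra). nra.
Qed.

(** This removes power series from everything that follows. *)
Lemma class_A_iff (f : C -> C) :
  class_A f <-> analytic_on_disk f /\ f 0 = 0 /\ is_cderive f 0 1.
Proof.
  split.
  - intros [Hf [a [A0 [A1 Ha]]]]. destruct (pseries_head a f Ha) as [H0 H1].
    rewrite A0 in H0. rewrite A1 in H1. auto.
  - intros [Hf [H0 H1]]. split; [exact Hf|].
    destruct (taylor_expansion f Hf) as [a Ha]. exists a.
    destruct (pseries_head a f Ha) as [K0 K1].
    split; [congruence|]. split; [|exact Ha].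
    exact (is_cderive_unique f 0 _ _ K1 H1).
Qed.

(** * Starlike quotients *)

Lemma is_cderive_id_mult_0 (u : C -> C) : analytic_on_disk u ->
  is_cderive (fun z => z * u z) 0 (u 0).
Proof.
  intros Hu.
  destruct (analytic_cderive u 0 Hu) as [l Hl]; [unfold in_disk; rewrite Cmod_0; lra|].
  eapply is_cderive_eq.
  - apply is_cderive_mult; [apply is_cderive_id|exact Hl].
  - cbv beta. ring.
Qed.

Lemma class_A_factor (f : C -> C) : class_A f ->
  exists u, analytic_on_disk u /\ u 0 = 1 /\ forall z, f z = z * u z.
Proof.
  intros Hf. apply class_A_iff in Hf. destruct Hf as [Hf [H0 H1]].
  destruct (factor_zero f Hf H0) as [u [Hu E]]. exists u.
  split; [exact Hu|]. split; [|exact E].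
  apply (is_cderive_unique f 0); [|exact H1].
  apply (is_cderive_ext_loc (fun z => z * u z) f 0 _ 1); [lra|intros y _; symmetry; apply E|].
  apply is_cderive_id_mult_0. exact Hu.
Qed.

Lemma class_A_intro (f u : C -> C) : analytic_on_disk u -> u 0 = 1 ->
  (forall z, f z = z * u z) -> class_A f.
Proof.
  intros Hu Hu0 E. apply class_A_iff. split; [|split].
  - apply analytic_intro. intros z Hz.
    destruct (analytic_cderive _ z (analytic_mult _ _ analytic_id Hu) Hz) as [l Hl].
    exists l. apply (is_cderive_ext_loc (fun z => z * u z) f z l 1);
      [lra|intros y _; symmetry; apply E|exact Hl].
  - rewrite E. ring.
  - rewrite <- Hu0.
    apply (is_cderive_ext_loc (fun z => z * u z) f 0 (u 0) 1);
      [lra|intros y _; symmetry; apply E|apply is_cderive_id_mult_0; exact Hu].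
Qed.

(** Dividing by z is harmless at 0, where the total division gives 0, since
    g = z u and h = z v give g h / z = z (u v) everywhere. *)
Lemma class_A_product (g h : C -> C) : class_A g -> class_A h ->
  class_A (fun z => g z * h z / z).
Proof.
  intros Hg Hh. destruct (class_A_factor g Hg) as [u [Hu [Hu0 Eu]]].
  destruct (class_A_factor h Hh) as [v [Hv [Hv0 Ev]]].
  apply (class_A_intro _ (fun z => u z * v z)).
  - apply analytic_mult; assumption.
  - rewrite Hu0, Hv0. ring.
  - intros z. rewrite Eu, Ev. destruct (Ceq_dec z 0) as [->|Hz].
    + unfold Cdiv. ring.
    + field. exact Hz.
Qed.

Lemma starlike_quotient_off_0 (f : C -> C) (z l : C) : z <> 0 -> is_cderive f z l ->
  starlike_quotient f z = z * l / f z.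
Proof.
  intros Hz Hl. unfold starlike_quotient.
  destruct (Req_EM_T (Cmod z) 0) as [E|_].
  - apply Cmod_eq_0 in E. contradiction.
  - rewrite (is_C_derive_unique f z l Hl). reflexivity.
Qed.

Lemma starlike_quotient_product (g h : C -> C) (z : C) :
  analytic_on_disk g -> analytic_on_disk h -> in_disk z -> z <> 0 ->
  g z <> 0 -> h z <> 0 ->
  starlike_quotient (fun z => g z * h z / z) z =
  starlike_quotient g z + starlike_quotient h z - 1.
Proof.
  intros Hg Hh Hz Hz0 Hgz Hhz.
  destruct (analytic_cderive g z Hg Hz) as [l Hl].
  destruct (analytic_cderive h z Hh Hz) as [m Hm].
  rewrite (starlike_quotient_off_0 g z l Hz0 Hl), (starlike_quotient_off_0 h z m Hz0 Hm).
  erewrite (starlike_quotient_off_0 (fun z => g z * h z / z)); [|exact Hz0|].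
  2: { apply (is_cderive_mult (fun z => g z * h z) (fun z => / z)).
       - apply is_cderive_mult; eassumption.
       - apply is_cderive_inv. exact Hz0. }
  cbv beta. field. auto.
Qed.

(** The extremal function: psi - 1 = z u, and with U the primitive of u
    vanishing at 0, g = z exp U satisfies z g' / g = 1 + z u = psi. *)
Lemma starlike_function_exists (psi : C -> C) : caratheodory psi ->
  exists g, starlike_class psi g /\ forall z, in_disk z -> starlike_quotient g z = psi z.
Proof.
  intros [Hpsi [H1 _]].
  destruct (factor_zero (fun z => psi z + - (1))) as [u [Hu Eu]].
  { apply analytic_plus; [exact Hpsi|apply analytic_const]. }
  { rewrite H1. ring. }
  destruct (primitive_exists u Hu) as [U [HU0 HU]].
  assert (HUa : analytic_on_disk U).
  { apply analytic_intro. intros z Hz. exists (u z). exact (HU z Hz). }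
  set (g z := z * cexp (U z)).
  assert (Hq : forall z, in_disk z -> starlike_quotient g z = psi z).
  { intros z Hz. destruct (Ceq_dec z 0) as [->|Hz0].
    - unfold starlike_quotient. rewrite Cmod_0.
      destruct (Req_EM_T 0 0) as [_|N]; [symmetry; exact H1|congruence].
    - erewrite starlike_quotient_off_0; [|exact Hz0|].
      2: { apply is_cderive_mult; [apply is_cderive_id|].
           apply (is_cderive_comp cexp U); [apply is_cderive_cexp|apply HU; exact Hz]. }
      unfold g. transitivity (1 + z * u z).
      + field. split; [apply cexp_neq_0|exact Hz0].
      + rewrite <- Eu. ring. }
  exists g. split; [|exact Hq]. split; [|split].
  - apply (class_A_intro g (fun z => cexp (U z))).
    + apply analytic_cexp; exact HUa.
    + rewrite HU0. apply cexp_0.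
    + reflexivity.
  - intros z _ Hz0. unfold g. apply Cmult_neq_0; [exact Hz0|apply cexp_neq_0].
  - exists (fun z => z). split; [|exact Hq].
    split; [apply analytic_id|]. split; [reflexivity|auto].
Qed.

(** * Caratheodory functions on the positive axis *)

(** The hypothesis compares points of one circle; the maximum principle extends
    the comparison to the closed disk, so that the value at a Schwarz function
    of z is controlled by |z| alone. *)
Lemma Re_le_on_axis (psi : C -> C) (r : R) (w : C) :
  analytic_on_disk psi -> max_Re_on_positive_axis psi -> (0 < r < 1)%R ->
  (Cmod w <= r)%R -> (Re (psi w) <= Re (psi (RtoC r)))%R.
Proof.
  intros Hpsi Hmax Hr Hw. destruct (Hmax r Hr) as [m [[_ Hm] E]].
  rewrite <- E, re_RtoC. destruct Hw as [Hw|Hw]; [|apply Hm; exact Hw].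
  apply (max_real_part psi r); [exact Hpsi|lra|exact Hm].
Qed.

Lemma Im_on_axis (psi : C -> C) (r : R) :
  max_Re_on_positive_axis psi -> (0 < r < 1)%R -> Im (psi (RtoC r)) = 0%R.
Proof.
  intros Hmax Hr. destruct (Hmax r Hr) as [m [_ E]]. rewrite <- E. apply im_RtoC.
Qed.

Lemma Re_continuous_on_axis (psi : C -> C) (r : R) : analytic_on_disk psi ->
  (0 <= r < 1)%R -> continuity_pt (fun x => Re (psi (RtoC x))) r.
Proof.
  intros Hpsi Hr. apply continuity_pt_filterlim.
  destruct (analytic_cderive psi (RtoC r) Hpsi) as [l Hl].
  { unfold in_disk. rewrite Cmod_R, Rabs_pos_eq; lra. }
  apply (continuous_comp (fun x => psi (RtoC x)) (fun z : C => fst z)).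
  - apply (continuous_comp RtoC psi).
    + apply (ex_derive_continuous (K:=R_AbsRing) (V:=C_R_NormedModule)).
      exists (RtoC 1). apply is_curve_derive_RtoC.
    + exact (is_cderive_continuous psi (RtoC r) l Hl).
  - apply continuous_fst.
Qed.

(** * First zero of a real function *)

(** The supremum s of the lower bounds of the set of zeros is itself a zero:
    otherwise phi would not vanish near s, by continuity, and s could be
    increased. Since phi 0 < 0, it is positive. *)
Lemma least_zero_exists (phi : R -> R) :
  (forall x, (0 <= x < 1)%R -> continuity_pt phi x) -> (phi 0 < 0)%R ->
  (exists x, (0 < x < 1)%R /\ phi x = 0%R) ->
  exists x0, (0 < x0 < 1)%R /\ phi x0 = 0%R /\
    forall x, (0 < x < 1)%R -> phi x = 0%R -> (x0 <= x)%R.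
Proof.
  intros Hc H0 [x1 [Hx1 E1]].
  set (lower x := forall y, (0 < y < 1)%R -> phi y = 0%R -> (x <= y)%R).
  destruct (completeness lower) as [s [Hs1 Hs2]].
  - exists x1. intros x Hx. apply Hx; assumption.
  - exists 0%R. intros y Hy _. lra.
  - assert (Hs0 : (0 <= s)%R) by (apply Hs1; intros y Hy _; lra).
    assert (Hlow : lower s).
    { intros y Hy Ey. apply Hs2. intros x Hx. apply Hx; assumption. }
    assert (Hsx : (s <= x1)%R) by (apply Hlow; assumption).
    assert (Es : phi s = 0%R).
    { apply NNPP. intros Hne.
      destruct (Hc s ltac:(lra) (Rabs (phi s))) as [d [Hd Hd']].
      { apply Rabs_pos_lt. exact Hne. }
      assert (Hup : lower (s + d / 2)%R).
      { intros y Hy Ey. apply Rnot_lt_le. intros Hlt. specialize (Hlow y Hy Ey).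
        assert (Hys : y <> s) by (intros ->; contradiction).
        specialize (Hd' y). simpl in Hd'. unfold Rdist, D_x, no_cond in Hd'.
        rewrite Ey in Hd'.
        replace (Rabs (0 - phi s)) with (Rabs (phi s)) in Hd'
          by (rewrite <- Rabs_Ropp; f_equal; ring).
        assert (Rabs (phi s) < Rabs (phi s))%R; [|lra].
        apply Hd'. split; [split; [exact I|auto]|].
        rewrite Rabs_pos_eq; lra. }
      specialize (Hs1 _ Hup). lra. }
    exists s. split; [|split; [exact Es|exact Hlow]].
    split; [|lra]. destruct Hs0 as [Hs0|Hs0]; [exact Hs0|]. rewrite <- Hs0 in Es. lra.
Qed.

Lemma negative_before_first_zero (phi : R -> R) (b : R) :
  (forall x, (0 <= x < 1)%R -> continuity_pt phi x) -> (phi 0 < 0)%R -> (b <= 1)%R ->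
  (forall x, (0 < x < b)%R -> phi x <> 0%R) ->
  forall x, (0 < x < b)%R -> (phi x < 0)%R.
Proof.
  intros Hc H0 Hb Hno x Hx. apply Rnot_le_lt. intros [Hlt|E].
  - destruct (Ranalysis5.IVT_interv phi 0 x) as [y [Hy Ey]]; [|lra|exact H0|exact Hlt|].
    + intros a Ha. apply Hc. lra.
    + apply (Hno y); [|exact Ey].
      destruct (Req_dec y 0) as [->|]; lra.
  - apply (Hno x Hx). symmetry. exact E.
Qed.

(** * The radius of the product *)

(* A radius larger than 1 would leave the unit disk, where g and h are
   defined, so sharpness compares r_beta with the radii rho <= 1. *)
Theorem theorem3p1 (psi1 psi2 : C -> C) (beta : R)
    (hpsi1 : caratheodory psi1) (hpsi2 : caratheodory psi2)
    (hmax1 : max_Re_on_positive_axis psi1)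
    (hmax2 : max_Re_on_positive_axis psi2)
    (hbeta : (1 < beta)%R) :
  exists rbeta : R,
    is_radius psi1 psi2 beta rbeta /\
    (forall g h : C -> C,
       starlike_class psi1 g -> starlike_class psi2 h ->
       class_M_in_disk beta rbeta (fun z : C => g z * h z / z)) /\
    (forall rho : R, (rbeta < rho <= 1)%R ->
       ~ (forall g h : C -> C,
            starlike_class psi1 g -> starlike_class psi2 h ->
            class_M_in_disk beta rho (fun z : C => g z * h z / z))).
Proof.
  assert (Ha1 : analytic_on_disk psi1) by apply hpsi1.
  assert (Ha2 : analytic_on_disk psi2) by apply hpsi2.
  set (phi r := (Re (psi1 (RtoC r)) + Re (psi2 (RtoC r)) - (1 + beta))%R).
  assert (Hc : forall x, (0 <= x < 1)%R -> continuity_pt phi x).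
  { intros x Hx. apply continuity_pt_minus.
    - apply (continuity_pt_plus (fun r => Re (psi1 (RtoC r))));
        apply Re_continuous_on_axis; assumption.
    - apply continuity_pt_const. intros a b. reflexivity. }
  assert (H0 : (phi 0 < 0)%R).
  { unfold phi. destruct hpsi1 as [_ [-> _]], hpsi2 as [_ [-> _]].
    rewrite re_RtoC. lra. }
  assert (Hroot : forall r, is_root psi1 psi2 beta r <-> (0 < r < 1)%R /\ phi r = 0%R).
  { intros r. unfold is_root. split; intros [Hr E]; (split; [exact Hr|]).
    - apply (f_equal Re) in E. unfold phi, Cminus in *.
      rewrite !re_plus, !re_opp, !re_RtoC in E. lra.
    - assert (I1 := Im_on_axis psi1 r hmax1 Hr). assert (I2 := Im_on_axis psi2 r hmax2 Hr).
      unfold phi in E. revert E I1 I2.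
      destruct (psi1 (RtoC r)) as [a1 b1], (psi2 (RtoC r)) as [a2 b2]. simpl. intros.
      unfold RtoC, Cminus, Cplus, Copp; simpl. f_equal; lra. }
  (* Membership holds up to any radius below which phi stays negative. *)
  assert (Hin : forall rho, (rho <= 1)%R -> (forall r, (0 < r < rho)%R -> (phi r < 0)%R) ->
    forall g h : C -> C, starlike_class psi1 g -> starlike_class psi2 h ->
       class_M_in_disk beta rho (fun z : C => g z * h z / z)).
  { intros rho Hrho Hneg g h [Hg [Ng [w1 [Hw1 E1]]]] [Hh [Nh [w2 [Hw2 E2]]]].
    split; [apply class_A_product; assumption|]. split.
    - intros z Hz Hz0.
      assert (Hgz : g z <> 0) by (apply Ng; [lra|exact Hz0]).
      assert (Hhz : h z <> 0) by (apply Nh; [lra|exact Hz0]).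
      apply Cmult_neq_0; [apply Cmult_neq_0; assumption|].
      intros E. apply C1_nz. rewrite <- (Cinv_r z Hz0), E. ring.
    - intros z Hz. assert (Hd : in_disk z) by (unfold in_disk; lra).
      destruct (Ceq_dec z 0) as [->|Hz0].
      { unfold starlike_quotient. rewrite Cmod_0.
        destruct (Req_EM_T 0 0) as [_|N]; [rewrite re_RtoC; exact hbeta|congruence]. }
      rewrite starlike_quotient_product; try assumption;
        [|apply Hg|apply Hh|apply Ng; [exact Hd|exact Hz0]|apply Nh; [exact Hd|exact Hz0]].
      rewrite E1, E2 by exact Hd.
      assert (Hr : (0 < Cmod z < rho)%R) by (split; [apply Cmod_gt_0; exact Hz0|exact Hz]).
      specialize (Hneg (Cmod z) Hr). unfold phi in Hneg.
      assert (B1 := Re_le_on_axis psi1 (Cmod z) (w1 z) Ha1 hmax1 ltac:(lra) (schwarz_lemma w1 z Hw1 Hd)).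
      assert (B2 := Re_le_on_axis psi2 (Cmod z) (w2 z) Ha2 hmax2 ltac:(lra) (schwarz_lemma w2 z Hw2 Hd)).
      unfold Cminus. rewrite !re_plus, re_opp, re_RtoC. lra. }
  destruct (classic (exists x, (0 < x < 1)%R /\ phi x = 0%R)) as [Hex|Hno].
  - destruct (least_zero_exists phi Hc H0 Hex) as [r0 [Hr0 [E0 Hleast]]].
    exists r0. split; [|split].
    + left. exists r0. split; [|rewrite Rmin_right; lra].
      split; [apply Hroot; auto|]. intros r Hr. apply Hroot in Hr.
      apply Hleast; apply Hr.
    + apply Hin; [lra|]. apply negative_before_first_zero; try assumption; [lra|].
      intros x Hx Ex. specialize (Hleast x ltac:(lra) Ex). lra.
    (* The extremal pair attains the value beta at the point r0. *)
    + intros rho Hrho Hall.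
      destruct (starlike_function_exists psi1 hpsi1) as [g [Hg Eg]].
      destruct (starlike_function_exists psi2 hpsi2) as [h [Hh Eh]].
      destruct (Hall g h Hg Hh) as [_ [_ HM]].
      assert (Hmod : Cmod (RtoC r0) = r0) by (rewrite Cmod_R; apply Rabs_pos_eq; lra).
      assert (Hd : in_disk (RtoC r0)) by (unfold in_disk; lra).
      assert (Hne : RtoC r0 <> 0) by (intros E; apply RtoC_inj in E; lra).
      specialize (HM (RtoC r0) ltac:(lra)).
      rewrite starlike_quotient_product in HM; try assumption;
        [|apply Hg|apply Hh|apply Hg; [exact Hd|exact Hne]|apply Hh; [exact Hd|exact Hne]].
      rewrite Eg, Eh in HM by exact Hd.
      unfold Cminus in HM. rewrite !re_plus, re_opp, re_RtoC in HM.
      unfold phi in E0. lra.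
  - exists 1%R. split; [|split].
    + right. split; [|reflexivity]. intros r Hr. apply Hno. exists r. apply Hroot. exact Hr.
    + apply Hin; [lra|]. apply negative_before_first_zero; try assumption; [lra|].
      intros x Hx Ex. apply Hno. exists x. auto.
    + intros rho Hrho. lra.
Qed.
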